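(* Let $r>0$ and let $\Gamma_t\subset\mathcal{H}$ ($t\ge0$) be the horizontal mean curvature flow with $\Gamma_0=\{p\in\mathcal{H}:|p|=r\}$. Then its extinction time is $T=r^2/\sqrt{12}$, and the normalized flow satisfies $$\frac{\Gamma_t}{\sqrt{r^4-12t^2}}\to E_T\quad\text{as }t\to T\ (t<T),$$ where $E_T=\{P\in\mathcal{H}:12T(P_1^2+P_2^2)+16P_3^2=1\}$.
   Context: The Heisenberg group $\mathcal{H}$ is $\mathbb{R}^3$ with the multiplication $(p_1,p_2,p_3)\cdot(q_1,q_2,q_3)=(p_1+q_1,\,p_2+q_2,\,p_3+q_3+\tfrac12(p_1q_2-q_1p_2))$ and Korányi gauge $|p|=((p_1^2+p_2^2)^2+16p_3^2)^{1/4}$. Set $X_1=\partial_{p_1}-\tfrac{p_2}{2}\partial_{p_3}$, $X_2=\partial_{p_2}+\tfrac{p_1}{2}\partial_{p_3}$, $\nabla_Hu=(X_1u,X_2u)$, and let $(\nabla_H^2u)^\ast$ be the symmetric $2\times2$ matrix with diagonal entries $X_1^2u$, $X_2^2u$ and off-diagonal entries $\tfrac12(X_1X_2u+X_2X_1u)$. Viscosity solutions. For $\eta\in\mathbb{R}^2\setminus\{0\}$ and a symmetric $2\times 2$ matrix $Y$ put $F(\eta,Y)=-\operatorname{tr}\big((I-\frac{\eta\otimes\eta}{|\eta|^2})Y\big)$. Let $\mathcal{O}\subset\mathcal{H}\times(0,\infty)$ be open. An upper (resp. lower) semicontinuous, extended-real-valued function $u$ on $\mathcal{O}$ is a subsolution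 (resp. supersolution) in $\mathcal{O}$ of $u_t+F(\nabla_Hu,(\nabla_H^2u)^\ast)=0$ if (i) $u<\infty$ (resp. $u>-\infty$) in $\mathcal{O}$; and (ii) whenever $\phi$ is a smooth function on $\mathcal{O}$ and $u-\phi$ attains a (finite) maximum (resp. minimum) over $\mathcal{O}$ at $(\hat p,\hat t)$, then at $(\hat p,\hat t)$: $\phi_t+F(\nabla_H\phi,(\nabla_H^2\phi)^\ast)\le0$ (resp. $\ge0$) if $\nabla_H\phi\ne0$; and $\phi_t\le0$ (resp. $\ge0$) if $\nabla_H\phi=0$ and $(\nabla_H^2\phi)^\ast=0$. A solution is both a subsolution and a supersolution. Axisymmetric (about the vertical axis): invariant when $(p_1,p_2,p_3)$ is replaced by $(p_1',p_2',p_3)$ with $(p_1')^2+(p_2')^2=p_1^2+p_2^2$ (for each fixed $t$). Horizontal mean curvature flow from a compact axisymmetric set $\Gamma_0$: choose $u_0\in C(\mathcal{H})$ axisymmetric, constant outside a compact set, with $\Gamma_0=\{p:u_0(p)=0\}$; let $u\in C(\mathcal{H}\times[0,\infty))$ be the unique spatially axisymmetric function with $u(\cdot,0)=u_0$ that solves $u_t+F(\nabla_Hu,(\nabla_H^2u)^\ast)=0$ in $\mathcal{H}\times(0,\infty)$ and, for each $T'>0$, is equal to a constant on $(\mathcal{H}\setminus K_{T'})\times[0,T']$ for some compact $K_{T'}$; put $\Gamma_t=\{p:u(p,t)=0\}$. (The sets $\Gamma_t$ do not depend on the choice of $u_0$.) $T\ge0$ is the extinction time of $\Gamma_t$ if $\Gamma_t\ne\emptyset$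 for $t\le T$ and $\Gamma_t=\emptyset$ for $t>T$. For $\lambda>0$, $\Gamma_t/\lambda=\{(p_1/\lambda,p_2/\lambda,p_3/\lambda):p\in\Gamma_t\}$. Convergence of the sets $S_t=\Gamma_t/\sqrt{r^4-12t^2}$ to $E_T$ as $t\to T$ means: every limit of a sequence $P_j\in S_{t_j}$ with $t_j\to T$, $t_j<T$, belongs to $E_T$; and for every $P\in E_T$ there are $P(t)\in S_t$ with $P(t)\to P$ as $t\to T$. *)

(* Defs.v *)
From HB Require Import structures.
From mathcomp Require Import all_boot all_order all_algebra.
From mathcomp Require Import all_classical all_reals all_analysis.
Set Implicit Arguments.
Unset Strict Implicit.
Unset Printing Implicit Defensive.
Import Order.TTheory GRing.Theory Num.Theory.
Import numFieldNormedType.Exports.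
Local Open Scope classical_set_scope.
Local Open Scope ring_scope.

Notation heis R := 'rV[R]_3.
Notation spacetime R := ('rV[R]_3 * R)%type.

Section Heisenberg.
Variable R : realType.
Implicit Types (p q : heis R) (f : spacetime R -> R).

Definition coord1 p : R := p 0 0.
Definition coord2 p : R := p 0 1.
Definition coord3 p : R := p 0 2%:R.

Definition hpoint (a b c : R) : heis R :=
  \row_(i < 3) [:: a; b; c]`_i.

(* The group law enters the horizontal mean curvature flow only through [X1]
   and [X2], which are left-invariant for it. *)
Definition hmul p q : heis R :=
  hpoint (coord1 p + coord1 q) (coord2 p + coord2 q)
    (coord3 p + coord3 q
     + 2^-1 * (coord1 p * coord2 q - coord1 q * coord2 p)).

Definition koranyi p : R :=
  ((coord1 p ^+ 2 + coord2 p ^+ 2) ^+ 2 + 16 * coord3 p ^+ 2) `^ (4^-1).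

Definition d_space (i : 'I_3) f : spacetime R -> R :=
  fun x => 'D_((delta_mx 0 i : heis R), (0 : R)) f x.

Definition d_time f : spacetime R -> R :=
  fun x => 'D_((0 : heis R), (1 : R)) f x.

Definition X1 f : spacetime R -> R :=
  fun x => d_space 0 f x - coord2 x.1 / 2 * d_space 2%:R f x.

Definition X2 f : spacetime R -> R :=
  fun x => d_space 1 f x + coord1 x.1 / 2 * d_space 2%:R f x.

Definition hgrad f x : 'rV[R]_2 :=
  \row_(i < 2) [:: X1 f x; X2 f x]`_i.

Definition hhess f x : 'M[R]_2 :=
  \matrix_(i < 2, j < 2)
    if i == j then (if i == 0 then X1 (X1 f) x else X2 (X2 f) x)
    else 2^-1 * (X1 (X2 f) x + X2 (X1 f) x).

(* The squared Euclidean norm: MathComp's [`|eta|] is the sup norm. *)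
Definition sqnorm (eta : 'rV[R]_2) : R := \sum_(i < 2) eta 0 i ^+ 2.

(* Only meaningful for [eta != 0]; vectors are rows, so [eta^T *m eta] is the
   tensor square of [eta]. *)
Definition mcf_op (eta : 'rV[R]_2) (Y : 'M[R]_2) : R :=
  - \tr ((1%:M - (sqnorm eta)^-1 *: (eta^T *m eta)) *m Y).

End Heisenberg.

Section Smooth.
Variables (R : realType) (V : normedModType R).

Fixpoint iter_derive (vs : seq V) (f : V -> R) : V -> R :=
  if vs is v :: vs' then iter_derive vs' (fun x => 'D_v f x) else f.

(* C^oo on the open set [O]: all iterated directional derivatives exist and are
   continuous on [O]; the values of [f] outside [O] are irrelevant. *)
Definition smooth_on (O : set V) (f : V -> R) : Prop :=
  forall (vs : seq V) (x : V), O x ->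
    (forall v, derivable (iter_derive vs f) x v) /\
    {for x, continuous (iter_derive vs f)}.

End Smooth.

Section Viscosity.
Variable R : realType.
Implicit Types (O : set (spacetime R)) (u : spacetime R -> \bar R).

Definition usc_on O u : Prop :=
  forall x, O x -> forall a : R, (u x < a%:E)%E ->
    \forall y \near within O (nbhs x), (u y < a%:E)%E.

Definition lsc_on O u : Prop :=
  forall x, O x -> forall a : R, (a%:E < u x)%E ->
    \forall y \near within O (nbhs x), (a%:E < u y)%E.

Definition max_on_at O (g : spacetime R -> \bar R) (x : spacetime R) : Prop :=
  [/\ O x, g x \is a fin_num & forall y, O y -> (g y <= g x)%E].

Definition min_on_at O (g : spacetime R -> \bar R) (x : spacetime R) : Prop :=
  [/\ O x, g x \is a fin_num & forall y, O y -> (g x <= g y)%E].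

(* [O] is meant to be an open subset of H x (0, oo). *)
Definition subsolution O u : Prop :=
  [/\ usc_on O u,
      forall x, O x -> (u x < +oo)%E &
      forall (phi : spacetime R -> R) (x : spacetime R),
        smooth_on O phi ->
        max_on_at O (fun y => (u y - (phi y)%:E)%E) x ->
        (hgrad phi x != 0 ->
           d_time phi x + mcf_op (hgrad phi x) (hhess phi x) <= 0) /\
        (hgrad phi x = 0 -> hhess phi x = 0 -> d_time phi x <= 0)].

Definition supersolution O u : Prop :=
  [/\ lsc_on O u,
      forall x, O x -> (-oo < u x)%E &
      forall (phi : spacetime R -> R) (x : spacetime R),
        smooth_on O phi ->
        min_on_at O (fun y => (u y - (phi y)%:E)%E) x ->
        (hgrad phi x != 0 ->
           0 <= d_time phi x + mcf_op (hgrad phi x) (hhess phi x)) /\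
        (hgrad phi x = 0 -> hhess phi x = 0 -> 0 <= d_time phi x)].

Definition solution O u : Prop := subsolution O u /\ supersolution O u.

End Viscosity.

Section Flow.
Variable R : realType.
Implicit Types (G : set (heis R)) (Gamma S : R -> set (heis R)).

Definition same_orbit (p q : heis R) : Prop :=
  coord1 p ^+ 2 + coord2 p ^+ 2 = coord1 q ^+ 2 + coord2 q ^+ 2 /\
  coord3 p = coord3 q.

Definition axisymmetric (f : heis R -> R) : Prop :=
  forall p q, same_orbit p q -> f p = f q.

Definition axisymmetric_set G : Prop :=
  forall p q, same_orbit p q -> G p -> G q.

Definition constant_outside_compact (f : heis R -> R) : Prop :=
  exists (K : set (heis R)) (c : R),
    compact K /\ forall p, ~ K p -> f p = c.

(* [u] represents a function on H x [0, oo): its values at negative times are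
   irrelevant. *)
Definition flow_function (u0 : heis R -> R) (u : spacetime R -> R) : Prop :=
  [/\ {within [set x : spacetime R | 0 <= x.2], continuous u},
      forall t, 0 <= t -> axisymmetric (fun p => u (p, t)),
      forall p, u (p, 0) = u0 p,
      solution [set x : spacetime R | 0 < x.2] (fun x => (u x)%:E) &
      forall T' : R, 0 < T' ->
        exists (K : set (heis R)) (c : R), compact K /\
          forall p t, ~ K p -> 0 <= t <= T' -> u (p, t) = c].

(* Existence and uniqueness of [u] given [u0], and independence of [Gamma] from
   the choice of [u0], are theorems and are not built into the definition. *)
Definition horizontal_mcf (G0 : set (heis R)) Gamma : Prop :=
  [/\ compact G0, axisymmetric_set G0 &
      exists (u0 : heis R -> R) (u : spacetime R -> R),
        [/\ continuous u0, axisymmetric u0, constant_outside_compact u0,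
            G0 = [set p | u0 p = 0] &
            flow_function u0 u /\
            forall t, 0 <= t -> Gamma t = [set p | u (p, t) = 0]]].

Definition extinction_time Gamma (T : R) : Prop :=
  [/\ 0 <= T,
      forall t, 0 <= t <= T -> Gamma t !=set0 &
      forall t, T < t -> Gamma t = set0].

Definition scale_set (lambda : R) G : set (heis R) :=
  [set lambda^-1 *: p | p in G].

Definition sets_converge_left S (T : R) (E : set (heis R)) : Prop :=
  (forall (t : nat -> R) (P : nat -> heis R) (Q : heis R),
     (forall j, 0 <= t j < T) -> (forall j, S (t j) (P j)) ->
     t j @[j --> \oo] --> T -> P j @[j --> \oo] --> Q -> E Q) /\
  (forall Q, E Q ->
     exists P : R -> heis R,
       (forall t, 0 <= t < T -> S t (P t)) /\ P t @[t --> T^'-] --> Q).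

End Flow.

(* Main.v *)
Require Import Defs.
From HB Require Import structures.
From mathcomp Require Import all_boot all_order all_algebra.
From mathcomp Require Import all_classical all_reals all_analysis.
From mathcomp Require Import ring lra.
Set Implicit Arguments.
Unset Strict Implicit.
Unset Printing Implicit Defensive.
Import Order.TTheory GRing.Theory Num.Theory.
Import numFieldNormedType.Exports.
Local Open Scope classical_set_scope.
Local Open Scope ring_scope.

(** With [rho = x^2 + y^2], the polynomial
    [w = rho^2 + 12 t rho + 16 z^2 + 12 t^2] satisfies [X_i X_j w = w_t delta_ij]
    after symmetrization, so that [f (w)] solves the level set equation off the
    vertical axis for every smooth [f].  The claim is [Gamma_t = {w (., t) = r^4}];
    extinction time and rescaled limit are then read off the polynomial.

    For a subsolution [u] with [u_0 < A] on [{w (., 0) = s}], one shows [u <= A] on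
    [{w (., t) = s}] by comparison with [A + C (w - s)^4 + eps g (t)], where [g]
    is an increasing entire function outgrowing [u], as test functions must be
    smooth and touch globally in time.  On the axis, where the definition of
    viscosity solutions gives nothing for this barrier, one maximizes instead
    [u (a . y, t) - A - C (|a|^4 + (w (y, t) - s)^4) - eps g (t)] over horizontal
    [a] as well, [a . y] being a left translation.  If [y] is on the axis at the
    maximum, moving [a] along its own direction leaves [w] unchanged to first
    order, whence [a = 0], and then [w > s] at second order; freezing the
    horizontal part of [y] at [0] instead of [a] gives the test function
    [C (w (0, 0, z, t) - s)^4 + C rho^2 + eps g (t)], whose horizontal gradient
    and Hessian vanish on the axis while its time derivative is positive. *)

(** * Smooth functions of time with prescribed growth *)

Section EntireSeries.
Variable R : realType.
Implicit Types c B : nat -> R.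

Definition entire c : Prop := forall x : R, cvgn (pseries c x).

(** The factor [n + 1] produced by differentiation is at most [2 ^ (n + 1)], so the new series at
    [x] is dominated by the absolute values of the old one at [2 (|x| + 1)]. *)
Lemma entire_diffs c : entire c -> entire (pseries_diffs c).
Proof.
move=> c_entire x; set y : R := 2 * (`|x| + 1).
have y_ge0 : 0 <= y by rewrite mulr_ge0// addr_ge0.
have cvg_y : cvgn (pseries (fun i => `|c i|) y).
  apply: (is_cvg_pseries_inside_norm (c_entire (y + 1))).
  by rewrite !ger0_norm ?addr_ge0// ltrDl.
have {}cvg_y : cvgn (series (fun i => `|c i.+1| * y ^+ i.+1)).
  rewrite (_ : series _ = (fun n => pseries (fun i => `|c i|) y n.+1 - `|c 0%N|)).
    apply: is_cvgB; last exact: is_cvg_cst.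
    by move/cvg_ex: cvg_y => [l yl]; apply/cvg_ex; exists l; rewrite cvg_shiftS.
  apply/funext => n.
  by rewrite /pseries /series /= big_nat_recl// expr0 mulr1 addrC addKr.
apply: normed_cvg; apply: series_le_cvg cvg_y => [n|n|n] /=.
- exact: normr_ge0.
- by rewrite mulr_ge0// exprn_ge0.
- rewrite /pseries_diffs 2!normrM normrX ger0_norm// /y exprMn mulrCA mulrA.
  apply: ler_pM; rewrite ?mulr_ge0 ?exprn_ge0//.
    by apply: ler_wpM2r => //; rewrite -natrX ler_nat; apply/ltnW/ltn_expl.
  apply: (@le_trans _ _ ((`|x| + 1) ^+ n)).
    by rewrite lerXn2r ?nnegrE ?addr_ge0// lerDl.
  by rewrite ler_weXn2l// lerDr.
Qed.

Lemma entire_iter_diffs c n : entire c -> entire (iter n (@pseries_diffs R) c).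
Proof. by move=> ?; elim: n => //= n; exact: entire_diffs. Qed.

Lemma is_derive_entire c (x : R) : entire c ->
  is_derive x (1 : R) (fun t => limn (pseries c t))
    (limn (pseries (pseries_diffs c) x)).
Proof.
move=> c_entire; apply: (@pseries_snd_diffs _ _ (`|x| + 1)) => //.
- exact: entire_diffs.
- by do 2 apply: entire_diffs.
- by rewrite [ltRHS]ger0_norm ?addr_ge0// ltrDl.
Qed.

Lemma pseries_ge_term c (x : R) k :
  entire c -> (forall n, 0 <= c n) -> 0 <= x ->
  c k * x ^+ k <= limn (pseries c x).
Proof.
move=> c_entire c_ge0 x_ge0.
have t_ge0 n : 0 <= c n * x ^+ n by rewrite mulr_ge0// exprn_ge0.
apply: (@le_trans _ _ (pseries c x k.+1)).
  by rewrite /pseries /series /= big_nat_recr//= lerDr; apply: sumr_ge0.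
apply: nondecreasing_cvgn_le; last exact: c_entire.
by apply: nondecreasing_series => n _ _; exact: t_ge0.
Qed.

Lemma bernoulli_ineq (h : R) n : 0 <= h -> 1 + n%:R * h <= (1 + h) ^+ n.
Proof.
move=> h_ge0; elim: n => [|n IHn]; first by rewrite mul0r addr0.
have n_ge0 : 0 <= n%:R :> R by [].
by rewrite exprS -natr1; nra.
Qed.

(* The base of the [k]-th coefficient grows so slowly in [k] that, for every
   [n], some monomial with base [n + 2] exceeds [B n] from [n + 3] on. *)
Fixpoint slow_base B (k : nat) : nat :=
  if k is k'.+1 then
    let n := slow_base B k' in
    (n + (B n <= ((n + 3)%:R / (n + 2)%:R) ^+ k')%R)%N
  else 0%N.

Definition fast_coef B (k : nat) : R := (slow_base B k + 2)%:R^-1 ^+ k.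

Lemma slow_base_homo B : {homo slow_base B : m n / (m <= n)%N}.
Proof.
apply: homo_leq => //; first exact: leq_trans.
by move=> n /=; exact: leq_addr.
Qed.

(** The base leaves [n] only when a power of [(n + 3) / (n + 2)] reaches [B n], which must happen as
    these powers are unbounded; moving by steps of one, it takes every value. *)
Lemma slow_base_reach B n : exists k,
  slow_base B k = n /\ B n <= ((n + 3)%:R / (n + 2)%:R) ^+ k.
Proof.
have step m k0 : slow_base B k0 = m -> exists k,
    slow_base B k = m /\ B m <= ((m + 3)%:R / (m + 2)%:R) ^+ k.
  move=> k0m; set q : R := _ / _.
  have q_gt1 : 1 < q.
    by rewrite ltr_pdivlMr ?ltr0n ?addn2// mul1r ltr_nat addn3.
  have [k1 Bk1] : exists k, B m <= q ^+ k.
    have h_gt0 : 0 < q - 1 by rewrite subr_gt0.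
    exists (Num.bound (`|B m| / (q - 1))).
    have /archi_boundP : 0 <= `|B m| / (q - 1) by rewrite divr_ge0// ltW.
    set k := Num.bound _; rewrite ltr_pdivrMr// => /ltW Bk.
    apply: (le_trans (ler_norm _)); apply: (le_trans Bk).
    have := @bernoulli_ineq (q - 1) k (ltW h_gt0).
    by rewrite [1 + (q - 1)]addrC subrK; apply: le_trans; rewrite lerDr.
  have [//|noreach] := pselect (exists k, slow_base B k = m /\ B m <= q ^+ k).
  suff stay d : slow_base B (k0 + d) = m.
    exists (k0 + k1)%N; split => //; apply: (le_trans Bk1).
    by rewrite ler_weXn2l ?leq_addl// ltW.
  elim: d => [|d IHd]; first by rewrite addn0.
  rewrite addnS /= IHd; case: (boolP (B m <= _)) => [Bd|_]; last by rewrite addn0.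
  by exfalso; apply: noreach; exists (k0 + d)%N.
elim: n => [|n [k [kn Bk]]]; first exact: (step 0%N 0%N).
by apply: (step _ k.+1); rewrite /= kn Bk addn1.
Qed.

Lemma fast_coef_ge0 B k : 0 <= fast_coef B k.
Proof. by rewrite exprn_ge0// invr_ge0 ler0n. Qed.

Lemma fast_coef_entire B : entire (fast_coef B).
Proof.
move=> x; pose m := Num.bound (2 * `|x|).
have xm : 2 * `|x| < m%:R by apply: archi_boundP; rewrite mulr_ge0.
have [k1 [k1m _]] := slow_base_reach B m.
(* [K] absorbs the terms before [k1]; from [k1] on the base exceeds [2 |x|], so the [n]-th term is
   at most [2 ^- n]. *)
pose K : R := (2 * `|x| + 1) ^+ k1.
have K_ge1 : 1 <= K by rewrite exprn_ege1// lerDr mulr_ge0.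
apply: normed_cvg.
apply: (@series_le_cvg _ _ (geometric K 2^-1)) => [n|n|n|] /=.
- exact: normr_ge0.
- by rewrite mulr_ge0 ?exprn_ge0 ?invr_ge0 ?ler0n// (le_trans ler01).
- set a := slow_base B n.
  rewrite normrM (ger0_norm (fast_coef_ge0 _ _)) normrX /fast_coef -/a -exprMn.
  have -> : (a + 2)%:R^-1 * `|x| = (a + 2)%:R^-1 * (2 * `|x|) * 2^-1 by field.
  rewrite exprMn; apply: ler_wpM2r; first by rewrite exprn_ge0// invr_ge0 ler0n.
  have [k1n|nk1] := leqP k1 n.
    apply: le_trans K_ge1; apply: exprn_ile1.
      by rewrite mulr_ge0 ?invr_ge0 ?ler0n// mulr_ge0.
    rewrite mulrC ler_pdivrMr ?ltr0n ?addn2// mul1r (le_trans (ltW xm))// ler_nat.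
    by rewrite -k1m (leq_trans (slow_base_homo B k1n))// -addn2 leq_addr.
  apply: (@le_trans _ _ ((2 * `|x| + 1) ^+ n)); last first.
    by rewrite ler_weXn2l// ?(ltnW nk1)// lerDr mulr_ge0.
  rewrite lerXn2r ?nnegrE ?addr_ge0 ?mulr_ge0 ?invr_ge0 ?ler0n//.
  rewrite mulrC ler_pdivrMr ?ltr0n ?addn2//.
  have a1 : 1 <= a.+2%:R :> R by rewrite ler1n.
  have := normr_ge0 x; nra.
- apply: is_cvg_geometric_series.
  by rewrite ger0_norm ?invr_ge0 ?ler0n// invf_lt1// ltr1n.
Qed.

(** The coefficients being nonnegative, a single monomial suffices: one with base [n + 2] is at
    least a power of [(n + 3) / (n + 2)] at [t]. *)
Lemma fast_coef_ge B n (t : R) : (n + 3)%:R <= t ->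
  B n <= limn (pseries (fast_coef B) t).
Proof.
move=> nt; have [k [kn Bk]] := slow_base_reach B n.
have t_ge0 : 0 <= t by apply: le_trans nt.
apply: (le_trans Bk); apply: le_trans (pseries_ge_term k _ _ t_ge0).
- rewrite /fast_coef kn -exprMn [_ * t]mulrC.
  rewrite lerXn2r ?nnegrE ?mulr_ge0 ?invr_ge0 ?ler0n//.
  by apply: ler_wpM2r => //; rewrite invr_ge0 ler0n.
- exact: fast_coef_entire.
- exact: fast_coef_ge0.
Qed.

(** [G 0] will be the time penalty of the barriers and [G n] is its [n]-th derivative; [G 1 > 0]
    makes the barriers strict, and [B] will encode bounds of the flow on longer and longer time
    intervals. *)
Lemma smooth_majorant B : exists G : nat -> R -> R,
  [/\ forall n t, is_derive t (1 : R) (G n) (G n.+1 t),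
      forall t, 0 <= t -> 0 <= G 0%N t,
      forall t, 0 <= t -> 0 < G 1%N t &
      forall n t, (n + 3)%:R <= t -> B n <= G 0%N t].
Proof.
pose c := fast_coef B.
exists (fun n t => limn (pseries (iter n (@pseries_diffs R) c) t)); split.
- by move=> n t /=; apply: is_derive_entire; exact/entire_iter_diffs/fast_coef_entire.
- move=> t t_ge0 /=; apply: le_trans (pseries_ge_term 0 _ _ t_ge0).
  + by rewrite expr0 mulr1; exact: fast_coef_ge0.
  + exact: fast_coef_entire.
  + exact: fast_coef_ge0.
- move=> t t_ge0 /=; apply: lt_le_trans (pseries_ge_term 0 _ _ t_ge0).
  + rewrite expr0 mulr1 /pseries_diffs mul1r /c /fast_coef expr1.
    by rewrite invr_gt0 ltr0n addn2.
  + exact/entire_diffs/fast_coef_entire.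
  + by move=> n; rewrite mulr_ge0// fast_coef_ge0.
- exact: fast_coef_ge.
Qed.

End EntireSeries.

(** * Symbolic test functions *)

Inductive coordinate := Xa | Xb | Xc | Xt.

(* Formal expressions in the coordinates and in the successive derivatives [G n]
   of a function of time: their iterated derivatives are again expressions, so
   they are smooth and the operators [X1] and [X2] can be computed by [ring]. *)
Inductive expr (R : Type) :=
| ECst of R
| EVar of coordinate
| EAdd of expr R & expr R
| EMul of expr R & expr R
| EFun of nat.
Arguments EVar {R}.
Arguments EFun {R}.

Definition derivative_chain (R : realType) (G : nat -> R -> R) : Prop :=
  forall n t, is_derive t (1 : R) (G n) (G n.+1 t).

Section Expressions.
Variables (R : realType) (G : nat -> R -> R).
Hypothesis G_derive : derivative_chain G.
Implicit Types (e : expr R) (x d : spacetime R).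

Definition coordinate_val (k : coordinate) x : R :=
  match k with
  | Xa => coord1 x.1 | Xb => coord2 x.1 | Xc => coord3 x.1 | Xt => x.2
  end.

Fixpoint evalx e x : R :=
  match e with
  | ECst c => c
  | EVar k => coordinate_val k x
  | EAdd e1 e2 => evalx e1 x + evalx e2 x
  | EMul e1 e2 => evalx e1 x * evalx e2 x
  | EFun n => G n x.2
  end.

Fixpoint der (k : coordinate) e : expr R :=
  match e with
  | ECst _ => ECst 0
  | EVar k' =>
    match k, k' with
    | Xa, Xa | Xb, Xb | Xc, Xc | Xt, Xt => ECst 1
    | _, _ => ECst 0
    end
  | EAdd e1 e2 => EAdd (der k e1) (der k e2)
  | EMul e1 e2 => EAdd (EMul e1 (der k e2)) (EMul e2 (der k e1))
  | EFun n => if k is Xt then EFun n.+1 else ECst 0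
  end.

Definition dir_der d e : expr R :=
  let term k := EMul (ECst (coordinate_val k d)) (der k e) in
  EAdd (EAdd (term Xa) (term Xb)) (EAdd (term Xc) (term Xt)).

Lemma continuous_coordinate k : continuous (coordinate_val k).
Proof.
case: k => x /=.
- by apply: (@continuous_comp _ _ _ fst (@coord1 R)); [exact: cvg_fst|exact: coord_continuous].
- by apply: (@continuous_comp _ _ _ fst (@coord2 R)); [exact: cvg_fst|exact: coord_continuous].
- by apply: (@continuous_comp _ _ _ fst (@coord3 R)); [exact: cvg_fst|exact: coord_continuous].
- exact: cvg_snd.
Qed.

Lemma continuous_eval e : continuous (evalx e).
Proof.
elim: e => [c|k|e1 IH1 e2 IH2|e1 IH1 e2 IH2|n] /=.
- exact: cst_continuous.
- exact: continuous_coordinate.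
- by move=> x; exact: cvgD (IH1 x) (IH2 x).
- by move=> x; exact: cvgM (IH1 x) (IH2 x).
- move=> x; apply: (@continuous_comp _ _ _ snd (G n)); first exact: cvg_snd.
  exact/differentiable_continuous/derivable1_diffP/(@ex_derive _ _ _ _ _ _ _ (G_derive n x.2)).
Qed.

Lemma is_derive_coordinate k x d :
  is_derive x d (coordinate_val k) (coordinate_val k d).
Proof.
have quot : \forall h \near 0^', h^-1 *: ((coordinate_val k \o shift x) (h *: d)
    - coordinate_val k x) = coordinate_val k d.
  near=> h; have h0 : h != 0 by near: h; exact: nbhs_dnbhs_neq.
  have -> : (coordinate_val k \o shift x) (h *: d) =
      h * coordinate_val k d + coordinate_val k x.
    by case: k => /=; rewrite /coord1 /coord2 /coord3 ?mxE.
  by rewrite addrK /GRing.scale /= mulKf.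
by split; [exact: is_cvg_near_cst quot|exact: lim_near_cst quot].
Unshelve. all: by end_near. Qed.

Lemma is_derive_time n x d :
  is_derive x d (fun y : spacetime R => G n y.2) (d.2 * G n.+1 x.2).
Proof.
have lin : is_derive (0 : R) (1 : R) (fun h : R => h * d.2 + x.2) d.2.
  have -> : (fun h : R => h * d.2 + x.2) = d.2 \*: (@id R) + cst x.2.
    by apply/funext => h; rewrite !fctE /= mulrC.
  by apply: is_derive_eq; rewrite addr0 [LHS]mulr1.
have Gx : is_derive ((0 : R) * d.2 + x.2) (1 : R) (G n) (G n.+1 x.2).
  by rewrite mul0r add0r; exact: G_derive.
have [cvg_quot lim_quot] := @is_derive1_comp R (G n) _ 0 _ _ Gx lin.
have quotE : (fun h : R => h^-1 *: (((G n \o (fun h : R => h * d.2 + x.2))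
      \o shift 0) (h *: 1) - (G n \o (fun h : R => h * d.2 + x.2)) 0)) =
    (fun h : R => h^-1 *: (((fun y : spacetime R => G n y.2) \o shift x) (h *: d)
      - G n x.2)).
  by apply/funext => h /=; rewrite addr0 mul0r add0r [h *: 1]mulr1.
split; first by rewrite /derivable -quotE.
by rewrite mulrC -lim_quot /derive -quotE.
Qed.

Lemma is_derive_eval e x d : is_derive x d (evalx e) (evalx (dir_der d e) x).
Proof.
elim: e => [c|k|e1 IH1 e2 IH2|e1 IH1 e2 IH2|n] /=.
- by rewrite !mulr0 !addr0; exact: is_derive_cst.
- rewrite [X in is_derive _ _ _ X](_ : _ = coordinate_val k d).
    exact: is_derive_coordinate.
  by case: k; rewrite /= ?mulr1 !mulr0 ?addr0 ?add0r.
- apply: (is_derive_eq (is_deriveD IH1 IH2)).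
  by rewrite /=; ring.
- apply: (is_derive_eq (is_deriveM IH1 IH2)).
  by rewrite /GRing.scale /=; ring.
- by rewrite !mulr0 !add0r; exact: is_derive_time.
Qed.

Lemma derive_eval d e x : 'D_d (evalx e) x = evalx (dir_der d e) x.
Proof. exact: (@derive_val _ _ _ _ _ _ _ (is_derive_eval e x d)). Qed.

Lemma iter_derive_eval ds e :
  iter_derive ds (evalx e) = evalx (foldl (fun e' d => dir_der d e') e ds).
Proof.
elim: ds e => //= d ds IH e; rewrite -IH; congr iter_derive.
by apply/funext => x; exact: derive_eval.
Qed.

Lemma smooth_eval O e : smooth_on O (evalx e).
Proof.
move=> ds x _; rewrite iter_derive_eval; split; last exact: continuous_eval.
by move=> d; exact: (@ex_derive _ _ _ _ _ _ _ (is_derive_eval _ x d)).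
Qed.

Definition X1_expr e : expr R :=
  EAdd (der Xa e) (EMul (EMul (ECst (- 2^-1)) (EVar Xb)) (der Xc e)).

Definition X2_expr e : expr R :=
  EAdd (der Xb e) (EMul (EMul (ECst 2^-1) (EVar Xa)) (der Xc e)).

Lemma d_time_eval e : d_time (evalx e) = evalx (der Xt e).
Proof.
apply/funext => x; rewrite /d_time derive_eval /=.
by rewrite /coord1 /coord2 /coord3 !mxE /=; ring.
Qed.

Lemma X1_eval e : X1 (evalx e) = evalx (X1_expr e).
Proof.
apply/funext => x; rewrite /X1 /d_space !derive_eval /=.
by rewrite /coord1 /coord2 /coord3 !mxE /=; field.
Qed.

Lemma X2_eval e : X2 (evalx e) = evalx (X2_expr e).
Proof.
apply/funext => x; rewrite /X2 /d_space !derive_eval /=.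
by rewrite /coord1 /coord2 /coord3 !mxE /=; field.
Qed.

Lemma hgrad_eval e x : hgrad (evalx e) x =
  \row_(i < 2) [:: evalx (X1_expr e) x; evalx (X2_expr e) x]`_i.
Proof. by rewrite /hgrad X1_eval X2_eval. Qed.

End Expressions.


(** * Viscosity inequalities for symbolic test functions *)

Section ViscosityTests.
Variable R : realType.
Implicit Types (e : expr R) (x : spacetime R) (v u : spacetime R -> R).

(* The subsolution inequality cleared of its denominator, for the test functions
   given by expressions. *)
Definition passes_tests v : Prop := forall G e x,
  derivative_chain G -> 0 < x.2 ->
  (forall y, 0 < y.2 -> v y - evalx G e y <= v x - evalx G e x) ->
  let E := evalx G ^~ x in
  let a := E (X1_expr e) in let b := E (X2_expr e) in
  let p := E (X1_expr (X1_expr e)) in let s := E (X2_expr (X2_expr e)) in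
  let q := E (X1_expr (X2_expr e)) + E (X2_expr (X1_expr e)) in
  let t := E (der Xt e) in
  (a ^+ 2 + b ^+ 2 != 0 ->
    (a ^+ 2 + b ^+ 2) * t <= b ^+ 2 * p - a * b * q + a ^+ 2 * s) /\
  (a = 0 -> b = 0 -> p = 0 -> s = 0 -> q = 0 -> t <= 0).

Lemma mcf_opE (a b p q s : R) : a ^+ 2 + b ^+ 2 != 0 ->
  (a ^+ 2 + b ^+ 2) * mcf_op (\row_(i < 2) [:: a; b]`_i)
    (\matrix_(i < 2, j < 2) if i == j then (if i == 0 then p else s) else q)
  = - (b ^+ 2 * p - a * b * (2 * q) + a ^+ 2 * s).
Proof.
move=> ab0; rewrite /mcf_op /sqnorm /mxtrace !big_ord_recl !big_ord0.
rewrite !mxE !big_ord_recl !big_ord0 !mxE !big_ord_recl !big_ord0 !mxE /=.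
by field.
Qed.

Section Hessian.
Variables (G : nat -> R -> R).
Hypothesis hG : derivative_chain G.

Lemma hhess_eval e x : hhess (evalx G e) x =
  \matrix_(i < 2, j < 2)
    if i == j then (if i == 0 then evalx G (X1_expr (X1_expr e)) x
                    else evalx G (X2_expr (X2_expr e)) x)
    else 2^-1 * (evalx G (X1_expr (X2_expr e)) x + evalx G (X2_expr (X1_expr e)) x).
Proof. by rewrite /hhess !X1_eval// !X2_eval// !X1_eval// !X2_eval. Qed.

Lemma hgrad_eval_eq0 e x : (hgrad (evalx G e) x == 0) =
  (evalx G (X1_expr e) x ^+ 2 + evalx G (X2_expr e) x ^+ 2 == 0).
Proof.
rewrite hgrad_eval// paddr_eq0 ?sqr_ge0// !sqrf_eq0.
apply/eqP/andP => [/rowP ab0|[/eqP -> /eqP ->]].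
  by have := ab0 0; have := ab0 1; rewrite !mxE /= => -> ->.
by apply/rowP => -[[|[|//]] i2]; rewrite !mxE.
Qed.

Lemma hhess_eval_eq0 e x :
  evalx G (X1_expr (X1_expr e)) x = 0 -> evalx G (X2_expr (X2_expr e)) x = 0 ->
  evalx G (X1_expr (X2_expr e)) x + evalx G (X2_expr (X1_expr e)) x = 0 ->
  hhess (evalx G e) x = 0.
Proof.
move=> p0 s0 q0; rewrite hhess_eval p0 s0 q0 mulr0.
by apply/matrixP => i j; rewrite !mxE !if_same.
Qed.

End Hessian.

Let upper : set (spacetime R) := [set x : spacetime R | 0 < x.2].

Lemma subsolution_passes_tests u :
  subsolution upper (fun x => (u x)%:E) -> passes_tests u.
Proof.
move=> [_ _ usub] G e x hG x_gt0 xmax; cbv zeta.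
have [|nz z] := usub (evalx G e) x (@smooth_eval _ _ hG _ _).
  split=> //= y y_gt0; rewrite -!EFinB lee_fin; exact: xmax.
rewrite -hgrad_eval_eq0//; split => [gnz|a0 b0 p0 s0 q0].
  have /= := nz gnz; rewrite d_time_eval// hhess_eval// hgrad_eval//.
  move: gnz; rewrite hgrad_eval_eq0// => ab0 ineq.
  have ab_gt0 : 0 < evalx G (X1_expr e) x ^+ 2 + evalx G (X2_expr e) x ^+ 2.
    by rewrite lt_def ab0 addr_ge0 ?sqr_ge0.
  move: ineq; rewrite -(pmulr_rle0 _ ab_gt0) mulrDr mcf_opE// subr_le0.
  by rewrite mulVKf ?pnatr_eq0//.
have := z _ (hhess_eval_eq0 hG p0 s0 q0); rewrite d_time_eval//; apply.
by apply/eqP; rewrite hgrad_eval_eq0// a0 b0 expr0n addr0.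
Qed.

(** The operator is odd in gradient and Hessian jointly, so testing [u] from below by [- e] amounts
    to testing [- u] from above by [e]. Lower bounds thus follow from the same comparison as upper
    bounds. *)
Lemma supersolution_passes_tests u :
  supersolution upper (fun x => (u x)%:E) -> passes_tests (fun x => - u x).
Proof.
move=> [_ _ usup] G e x hG x_gt0 xmax; cbv zeta.
pose e' := EMul (ECst (-1)) e.
have e'E y : evalx G e' y = - evalx G e y by rewrite /= mulN1r.
have tE : evalx G (der Xt e') x = - evalx G (der Xt e) x by rewrite /=; ring.
have aE : evalx G (X1_expr e') x = - evalx G (X1_expr e) x by rewrite /=; ring.
have bE : evalx G (X2_expr e') x = - evalx G (X2_expr e) x by rewrite /=; ring.
have pE : evalx G (X1_expr (X1_expr e')) x = - evalx G (X1_expr (X1_expr e)) x.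
  by rewrite /=; ring.
have sE : evalx G (X2_expr (X2_expr e')) x = - evalx G (X2_expr (X2_expr e)) x.
  by rewrite /=; ring.
have q1E : evalx G (X1_expr (X2_expr e')) x = - evalx G (X1_expr (X2_expr e)) x.
  by rewrite /=; ring.
have q2E : evalx G (X2_expr (X1_expr e')) x = - evalx G (X2_expr (X1_expr e)) x.
  by rewrite /=; ring.
have [|nz z] := usup (evalx G e') x (@smooth_eval _ _ hG _ _).
  split=> // y y_gt0; rewrite -!EFinB lee_fin !e'E.
  by have := xmax _ y_gt0; lra.
have ab_eq0 : (hgrad (evalx G e') x == 0) =
    (evalx G (X1_expr e) x ^+ 2 + evalx G (X2_expr e) x ^+ 2 == 0).
  by rewrite hgrad_eval_eq0// aE bE !sqrrN.
rewrite -ab_eq0; split => [gnz|a0 b0 p0 s0 q0].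
  have := nz gnz; rewrite d_time_eval// hhess_eval// hgrad_eval//.
  move: gnz; rewrite ab_eq0 => ab0.
  rewrite aE bE pE sE q1E q2E tE => ineq.
  have ab_gt0 : 0 < (- evalx G (X1_expr e) x) ^+ 2 + (- evalx G (X2_expr e) x) ^+ 2.
    by rewrite !sqrrN lt_def ab0 addr_ge0 ?sqr_ge0.
  move: ineq; rewrite -(pmulr_rge0 _ ab_gt0) mulrDr mcf_opE ?gt_eqF//.
  rewrite mulVKf ?pnatr_eq0//; lra.
have := z _ (hhess_eval_eq0 hG _ _ _); rewrite d_time_eval// tE oppr_ge0; apply.
- by apply/eqP; rewrite ab_eq0 a0 b0 expr0n addr0.
- by rewrite pE p0 oppr0.
- by rewrite sE s0 oppr0.
- by rewrite q1E q2E -opprD q0 oppr0.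
Qed.

(* The horizontal gradient of [f (Q)] for [f (h) = C h ^ 4] is [f' (Q)] times
   that of [Q], and the [f'' (Q)] part of its Hessian is not seen by the operator;
   moreover [f'' (h) = 0] wherever [f' (h) = 0]. *)
Definition quartic_test (c C eps : R) (Q : expr R) : expr R :=
  EAdd (ECst c) (EAdd (EMul (ECst C) (EMul (EMul Q Q) (EMul Q Q)))
                   (EMul (ECst eps) (EFun 0%N))).

Lemma eval_quartic_test G c C eps Q x :
  evalx G (quartic_test c C eps Q) x = c + C * evalx G Q x ^+ 4 + eps * G 0%N x.2.
Proof. by rewrite /=; ring. Qed.

(** The test function has horizontal gradient [k grad Q] and symmetrized Hessian
    [k Q_t I + l (grad Q)^T (grad Q)], with [k], [l] the first two derivatives of [C h ^ 4]. The
    projection kills the rank-one part, and the inequality reduces to [eps G 1 <= 0] unless the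
    gradient vanishes. *)
Lemma quartic_test_max v G c C eps Q x :
  passes_tests v -> derivative_chain G -> 0 < x.2 -> 0 < eps -> 0 < G 1%N x.2 ->
  (forall y, 0 < y.2 -> v y - evalx G (quartic_test c C eps Q) y <=
                        v x - evalx G (quartic_test c C eps Q) x) ->
  evalx G (X1_expr (X1_expr Q)) x = evalx G (der Xt Q) x ->
  evalx G (X2_expr (X2_expr Q)) x = evalx G (der Xt Q) x ->
  evalx G (X1_expr (X2_expr Q)) x + evalx G (X2_expr (X1_expr Q)) x = 0 ->
  [/\ evalx G Q x != 0, evalx G (X1_expr Q) x = 0 & evalx G (X2_expr Q) x = 0].
Proof.
move=> vP hG x_gt0 eps_gt0 G1_gt0 xmax pQ sQ qQ.
have [] := vP _ _ _ hG x_gt0 xmax.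
set a := evalx G (X1_expr Q) x; set b := evalx G (X2_expr Q) x.
set h := evalx G Q x; set t := evalx G (der Xt Q) x.
set A := evalx G (X1_expr _) x; set B := evalx G (X2_expr _) x.
set P := evalx G (X1_expr (X1_expr _)) x; set S := evalx G (X2_expr (X2_expr _)) x.
set U := evalx G (X1_expr (X2_expr _)) x + _; set T := evalx G (der Xt _) x.
pose k := 4 * C * h ^+ 3; pose l := 12 * C * h ^+ 2.
have AE : A = k * a by rewrite /A /k /a /h /=; ring.
have BE : B = k * b by rewrite /B /k /b /h /=; ring.
have TE : T = k * t + eps * G 1%N x.2 by rewrite /T /k /t /h /=; ring.
have PE : P = k * t + l * a ^+ 2.
  by rewrite -[t]pQ /P /k /l /a /h /=; ring.
have SE : S = k * t + l * b ^+ 2.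
  by rewrite -[t]sQ /S /k /l /b /h /=; ring.
have UE : U = 2 * l * a * b.
  transitivity (k * (evalx G (X1_expr (X2_expr Q)) x + evalx G (X2_expr (X1_expr Q)) x)
      + 2 * l * a * b).
    by rewrite /U /k /l /a /b /h /=; ring.
  by rewrite qQ mulr0 add0r.
have epsG : 0 < eps * G 1%N x.2 by rewrite mulr_gt0.
rewrite AE BE PE SE UE TE => nz z.
(* If [k = 0] then [l = 0] as well, gradient and Hessian of the test function vanish, and the
   degenerate clause forces [eps G 1 <= 0]. *)
have [k0|k_neq0] := eqVneq k 0.
  have l0 : l = 0.
    move/eqP: k0; rewrite mulf_eq0 expf_eq0 mulf_eq0 pnatr_eq0 /=.
    by rewrite /l => /orP[] /eqP ->; rewrite ?mulr0 ?mul0r// expr0n mulr0.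
  have : k * t + eps * G 1%N x.2 <= 0.
    by apply: z; rewrite ?k0 ?l0 !(mul0r, mulr0) ?addr0.
  by rewrite k0 mul0r add0r leNgt epsG.
have h_neq0 : h != 0.
  by apply: contraNneq k_neq0 => h0; rewrite /k h0 expr0n mulr0.
have [/eqP|ab_neq0] := eqVneq (a ^+ 2 + b ^+ 2) 0.
  by rewrite paddr_eq0 ?sqr_ge0// !sqrf_eq0 => /andP[/eqP -> /eqP ->].
have kab_gt0 : 0 < k ^+ 2 * (a ^+ 2 + b ^+ 2).
  by rewrite mulr_gt0 ?exprn_even_gt0// lt_def ab_neq0 addr_ge0 ?sqr_ge0.
have : 0 < k ^+ 2 * (a ^+ 2 + b ^+ 2) * (eps * G 1%N x.2) by rewrite mulr_gt0.
rewrite ltNge => /negP[]; have -> : k ^+ 2 * (a ^+ 2 + b ^+ 2) * (eps * G 1%N x.2)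
   = ((k * a) ^+ 2 + (k * b) ^+ 2) * (k * t + eps * G 1%N x.2)
    - ((k * b) ^+ 2 * (k * t + l * a ^+ 2) - k * a * (k * b) * (2 * l * a * b)
      + (k * a) ^+ 2 * (k * t + l * b ^+ 2)) by ring.
rewrite subr_le0; apply: nz.
have -> : (k * a) ^+ 2 + (k * b) ^+ 2 = k ^+ 2 * (a ^+ 2 + b ^+ 2) by ring.
by rewrite gt_eqF.
Qed.

End ViscosityTests.

(** * The explicit solution *)

Section Profile.
Variable R : realType.
Implicit Types (p y : heis R) (x : spacetime R) (v : spacetime R -> R).

Lemma coord1_hpoint (a b c : R) : coord1 (hpoint a b c) = a.
Proof. by rewrite /coord1 mxE. Qed.

Lemma coord2_hpoint (a b c : R) : coord2 (hpoint a b c) = b.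
Proof. by rewrite /coord2 mxE. Qed.

Lemma coord3_hpoint (a b c : R) : coord3 (hpoint a b c) = c.
Proof. by rewrite /coord3 mxE. Qed.

Definition coord_hpoint := (coord1_hpoint, coord2_hpoint, coord3_hpoint).

Lemma heisP p q : coord1 p = coord1 q -> coord2 p = coord2 q ->
  coord3 p = coord3 q -> p = q.
Proof.
move=> c1 c2 c3; apply/rowP => i.
have /or3P[] : [|| i == 0, i == 1 | i == 2%:R].
  by case: i => [[|[|[|//]]] ?].
all: by move=> /eqP ->.
Qed.

(* The level sets of [profile] move by horizontal mean curvature: [profile] solves
   the equation off the vertical axis, where the horizontal gradient vanishes. *)
Definition profile p (t : R) : R :=
  let rho := coord1 p ^+ 2 + coord2 p ^+ 2 in
  rho ^+ 2 + 12 * t * rho + 16 * coord3 p ^+ 2 + 12 * t ^+ 2.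

Section TranslatedProfile.
Variables (a b s : R).

(** [(y1, y2, y3)] is the current point multiplied on the left by [(-a, -b, 0)]. As [X1] and [X2]
    are left-invariant, the differential identities of [profile] survive this translation. *)
Definition translated_profile_expr : expr R :=
  let c := @ECst R in
  let y1 := EAdd (EVar Xa) (c (- a)) in
  let y2 := EAdd (EVar Xb) (c (- b)) in
  let y3 := EAdd (EVar Xc) (EMul (c (- 2^-1))
    (EAdd (EMul (c a) (EVar Xb)) (EMul (c (- b)) (EVar Xa)))) in
  let rho := EAdd (EMul y1 y1) (EMul y2 y2) in
  EAdd (EAdd (EMul rho rho) (EMul (c 12) (EMul (EVar Xt) rho)))
    (EAdd (EMul (c 16) (EMul y3 y3))
       (EAdd (EMul (c 12) (EMul (EVar Xt) (EVar Xt))) (c (- s)))).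

Let Q := translated_profile_expr.
Variables (G : nat -> R -> R) (y : heis R) (t : R).
Let x : spacetime R := (hmul (hpoint a b 0) y, t).

Let x1 : coord1 (hmul (hpoint a b 0) y) = a + coord1 y. Proof. by rewrite !coord_hpoint. Qed.
Let x2 : coord2 (hmul (hpoint a b 0) y) = b + coord2 y. Proof. by rewrite !coord_hpoint. Qed.
Let x3 : coord3 (hmul (hpoint a b 0) y) = coord3 y + 2^-1 * (a * coord2 y - coord1 y * b).
Proof. by rewrite !coord_hpoint add0r. Qed.

Lemma eval_translated_profile : evalx G Q x = profile y t - s.
Proof. by rewrite /= x1 x2 x3 /profile; field. Qed.

Lemma translated_profile_hess11 :
  evalx G (X1_expr (X1_expr Q)) x = evalx G (der Xt Q) x.
Proof. by rewrite /= x1 x2 x3; field. Qed.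

Lemma translated_profile_hess22 :
  evalx G (X2_expr (X2_expr Q)) x = evalx G (der Xt Q) x.
Proof. by rewrite /= x1 x2 x3; field. Qed.

Lemma translated_profile_hess12 :
  evalx G (X1_expr (X2_expr Q)) x + evalx G (X2_expr (X1_expr Q)) x = 0.
Proof. by rewrite /= x1 x2 x3; field. Qed.

Lemma translated_profile_grad :
  let rho := coord1 y ^+ 2 + coord2 y ^+ 2 in
  evalx G (X1_expr Q) x ^+ 2 + evalx G (X2_expr Q) x ^+ 2 =
  rho * ((4 * rho + 24 * t) ^+ 2 + 256 * coord3 y ^+ 2).
Proof. by rewrite /= x1 x2 x3; field. Qed.

End TranslatedProfile.

(** Here [n] stands for [|a|^2] and [m] for [profile y t - s]. Shifting the part [tau a] of [a] into
    [y] lowers the first term at order [tau] and raises the second only at order [tau ^ 2]. *)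
Lemma radial_min (n m t : R) : 0 <= n -> 0 <= t ->
  (forall tau, n ^+ 2 + m ^+ 4 <= (1 - tau) ^+ 4 * n ^+ 2 +
     (m + tau ^+ 4 * n ^+ 2 + 12 * t * tau ^+ 2 * n) ^+ 4) -> n = 0.
Proof.
move=> n_ge0 t_ge0 minP; apply/eqP; rewrite eq_le n_ge0 andbT leNgt.
apply/negP => n_gt0.
pose k := n ^+ 2 + 12 * t * n; pose mu := `|m|.
have mu_ge0 : 0 <= mu by exact: normr_ge0.
have k_ge0 : 0 <= k by rewrite addr_ge0 ?sqr_ge0// !mulr_ge0.
pose K := 4 * mu ^+ 3 + 6 * mu ^+ 2 * k + 4 * mu * k ^+ 2 + k ^+ 3.
have K_ge0 : 0 <= K by rewrite !addr_ge0 ?mulr_ge0 ?exprn_ge0.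
have n2_gt0 : 0 < n ^+ 2 by rewrite exprn_gt0.
have den_gt0 : 0 < 7 * n ^+ 2 + K * k.
  by rewrite ltr_wpDr ?mulr_ge0// mulr_gt0.
(* The first term drops by at least [(4 tau - 7 tau ^ 2) n ^ 2] and the second rises by at most
   [tau ^ 2 k K]; with this [tau] the quadratic terms add up to [tau n ^ 2], less than
   [4 tau n ^ 2]. *)
pose tau := n ^+ 2 / (7 * n ^+ 2 + K * k).
have tau_gt0 : 0 < tau by rewrite divr_gt0.
have tauE : tau * (7 * n ^+ 2 + K * k) = n ^+ 2 by rewrite /tau divfK ?gt_eqF.
have tau_le1 : tau <= 1.
  rewrite /tau ler_pdivrMr// mul1r; have := mulr_ge0 K_ge0 k_ge0; lra.
clearbody tau.
pose d := tau ^+ 4 * n ^+ 2 + 12 * t * tau ^+ 2 * n.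
have d_ge0 : 0 <= d.
  by rewrite addr_ge0 ?(mulr_ge0 (exprn_ge0 _ _))// ?mulr_ge0 ?sqr_ge0// ltW.
have d_le : d <= tau ^+ 2 * k.
  rewrite /d /k mulrDr lerD//; last by rewrite le_eqVlt; apply/orP; left; apply/eqP; ring.
  by apply: ler_wpM2r; [exact: ltW|apply: ler_wiXn2l => //; exact: ltW].
have dk : d <= k.
  apply: (le_trans d_le); rewrite -[leRHS]mul1r; apply: ler_wpM2r => //.
  by apply: exprn_ile1 => //; exact: ltW.
have m_le : m <= mu by exact: ler_norm.
have m2 : m ^+ 2 = mu ^+ 2 by rewrite real_normK// num_real.
have m3 : m ^+ 3 <= mu ^+ 3 by rewrite /mu -normrX ler_norm.
have growth : (m + d) ^+ 4 <= m ^+ 4 + d * K.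
  have -> : (m + d) ^+ 4 = m ^+ 4 +
      d * (4 * m ^+ 3 + 6 * m ^+ 2 * d + 4 * m * d ^+ 2 + d ^+ 3) by ring.
  rewrite lerD2l ler_wpM2l// /K m2 !lerD//.
  - by rewrite ler_wpM2l.
  - by rewrite ler_wpM2l// mulr_ge0// sqr_ge0.
  - apply: (@le_trans _ _ (4 * mu * d ^+ 2)).
      by rewrite ler_wpM2r ?sqr_ge0// ler_wpM2l.
    by rewrite ler_wpM2l ?mulr_ge0// lerXn2r.
  - by rewrite lerXn2r.
have dK : d * K <= tau ^+ 2 * k * K by rewrite ler_wpM2r.
have tau4 : (1 - tau) ^+ 4 <= 1 - 4 * tau + 7 * tau ^+ 2.
  have -> : (1 - tau) ^+ 4 = 1 - 4 * tau + 7 * tau ^+ 2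
    - tau ^+ 2 * (1 + tau * (4 - tau)) by ring.
  rewrite lerBlDr lerDl mulr_ge0 ?sqr_ge0// addr_ge0// mulr_ge0 ?(ltW tau_gt0)//; lra.
have tau4n : (1 - tau) ^+ 4 * n ^+ 2 <= (1 - 4 * tau + 7 * tau ^+ 2) * n ^+ 2.
  by rewrite ler_wpM2r// ltW.
have := minP tau; rewrite -addrA -/d => minT.
have : 4 * tau * n ^+ 2 <= tau * (tau * (7 * n ^+ 2 + K * k)).
  rewrite (_ : tau * (_ * _) = 7 * tau ^+ 2 * n ^+ 2 + tau ^+ 2 * k * K); last by ring.
  move: tau4n; rewrite !mulrDl mul1r; lra.
rewrite tauE; have := mulr_gt0 tau_gt0 n2_gt0; lra.
Qed.

(** For [m < 0], taking [a] of length [tau] and the opposite horizontal part in [y] raises the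
    profile at order [tau ^ 2], which lowers the fourth power at that order at the mere cost
    [tau ^ 4]. *)
Lemma horizontal_min (m t : R) : 0 < t ->
  (forall tau, m ^+ 4 <= tau ^+ 4 + (m + tau ^+ 4 + 12 * t * tau ^+ 2) ^+ 4) ->
  0 <= m.
Proof.
move=> t_gt0 minP; rewrite leNgt; apply/negP => m_lt0.
pose mu := - m; have mu_gt0 : 0 < mu by rewrite oppr_gt0.
have mu3 : 0 < mu ^+ 3 by rewrite exprn_gt0.
(* [th] is [tau ^ 2]. The first two bounds keep the increment [q] below [mu], so that [m + q <= 0];
   the third makes the cost [th ^ 2] smaller than the gain [mu ^ 3 q]. *)
pose th := Num.min (Num.min 1 (mu / (1 + 12 * t))) (12 * t * mu ^+ 3).
have den_gt0 : 0 < 1 + 12 * t by rewrite addr_gt0// mulr_gt0.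
have th_gt0 : 0 < th by rewrite !lt_min ltr01 divr_gt0// !mulr_gt0.
have th1 : th <= 1 by rewrite !ge_min lexx.
have th2 : th * (1 + 12 * t) <= mu by rewrite -ler_pdivlMr// !ge_min lexx orbT.
have th3 : th <= 12 * t * mu ^+ 3 by rewrite !ge_min lexx !orbT.
have := minP (Num.sqrt th).
rewrite (_ : Num.sqrt th ^+ 4 = th ^+ 2); last first.
  by rewrite (exprM _ 2 2) sqr_sqrtr// ltW.
rewrite (sqr_sqrtr (ltW th_gt0)) -addrA.
set q := th ^+ 2 + 12 * t * th.
have q_le : q <= mu.
  apply: le_trans th2; rewrite /q mulrDr mulr1 [th * _]mulrC lerD2r.
  by rewrite expr2 ler_piMl// ltW.
have q_ge : 12 * t * th < q by rewrite ltrDr exprn_gt0.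
have q_gt0 : 0 < q by apply: lt_trans q_ge; rewrite !mulr_gt0.
have mE : m = - mu by rewrite opprK.
have -> : (m + q) ^+ 4 = (mu - q) ^+ 3 * (mu - q) by rewrite mE; ring.
have -> : m ^+ 4 = mu ^+ 3 * mu by rewrite mE; ring.
have cube : (mu - q) ^+ 3 * (mu - q) <= mu ^+ 3 * (mu - q).
  rewrite ler_wpM2r ?subr_ge0// lerXn2r// ?nnegrE ?subr_ge0// ?(ltW mu_gt0)//.
  by rewrite lerBlDr lerDl ltW.
have lower : mu ^+ 3 * (12 * t * th) < mu ^+ 3 * q by rewrite ltr_pM2l.
have upper : th ^+ 2 <= 12 * t * mu ^+ 3 * th by rewrite expr2 ler_wpM2r// ltW.
lra.
Qed.

(* Doubling of the variables along horizontal left translations: test functions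
   in the point [a . y] are obtained both by freezing [a] and by freezing the
   horizontal part of [y]. *)
Lemma no_doubled_max v (C eps s : R) G (a b t : R) (y : heis R) :
  passes_tests v -> derivative_chain G -> (forall r, 0 <= r -> 0 < G 1%N r) ->
  0 < C -> 0 < eps -> 0 < t ->
  let J a b y t := v (hmul (hpoint a b 0) y, t)
    - C * ((a ^+ 2 + b ^+ 2) ^+ 2 + (profile y t - s) ^+ 4) - eps * G 0%N t in
  (forall a' b' y' t', 0 < t' -> J a' b' y' t' <= J a b y t) -> False.
Proof.
move=> vP hG G1 C_gt0 eps_gt0 t_gt0 J Jmax.
pose x0 : spacetime R := (hmul (hpoint a b 0) y, t).
have [|||||h_neq0 g1 g2] := @quartic_test_max R v G 0 C eps
    (translated_profile_expr a b s) x0 vP hG t_gt0 eps_gt0.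
- by apply: G1; exact: ltW.
- move=> [p r] r_gt0; rewrite !eval_quartic_test.
  pose y' : heis R := hmul (hpoint (- a) (- b) 0) p.
  have py' : hmul (hpoint a b 0) y' = p.
    by apply: heisP; rewrite !coord_hpoint; field.
  have := Jmax a b y' r r_gt0; rewrite /J py'.
  have -> : evalx G (translated_profile_expr a b s) (p, r) = profile y' r - s.
    by rewrite -(eval_translated_profile a b s G) py'.
  rewrite eval_translated_profile /=; lra.
- exact: translated_profile_hess11.
- exact: translated_profile_hess22.
- exact: translated_profile_hess12.
pose m := profile y t - s.
have m_neq0 : m != 0 by move: h_neq0; rewrite eval_translated_profile.
have rho0 : coord1 y ^+ 2 + coord2 y ^+ 2 = 0.
  have /esym/eqP := translated_profile_grad a b s G y t.
  rewrite -/x0 g1 g2 expr0n addr0 mulf_eq0 => /orP[/eqP//|].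
  rewrite gt_eqF//.
  have al_gt0 : 0 < 4 * (coord1 y ^+ 2 + coord2 y ^+ 2) + 24 * t.
    have := sqr_ge0 (coord1 y); have := sqr_ge0 (coord2 y); lra.
  have := exprn_gt0 2 al_gt0; have := sqr_ge0 (coord3 y); lra.
have [y1 y2] : coord1 y = 0 /\ coord2 y = 0.
  by move/eqP: rho0; rewrite paddr_eq0 ?sqr_ge0// !sqrf_eq0 => /andP[/eqP + /eqP].
have mE : m = 16 * coord3 y ^+ 2 + 12 * t ^+ 2 - s.
  by rewrite /m /profile rho0; ring.
have x0E : x0.1 = hpoint a b (coord3 y).
  by apply: heisP; rewrite !coord_hpoint ?y1 ?y2; ring.
have JE : J a b y t = v (hpoint a b (coord3 y), t)
    - C * ((a ^+ 2 + b ^+ 2) ^+ 2 + m ^+ 4) - eps * G 0%N t.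
  by rewrite /J -/m -x0E.
have drop V E P P' : V - C * P - E <= V - C * P' - E -> P' <= P.
  by rewrite lerD2r lerD2l lerN2 ler_pM2l.
(* The horizontal vectors [(1 - tau) a] and [tau a] are collinear, so their product is their sum and
   the argument of [v] does not move. *)
have n0 : a ^+ 2 + b ^+ 2 = 0.
  apply: (@radial_min _ m t); rewrite ?addr_ge0 ?sqr_ge0// ?(ltW t_gt0)// => tau.
  have := Jmax ((1 - tau) * a) ((1 - tau) * b)
    (hpoint (tau * a) (tau * b) (coord3 y)) t t_gt0.
  rewrite JE /J.
  have -> : hmul (hpoint ((1 - tau) * a) ((1 - tau) * b) 0)
      (hpoint (tau * a) (tau * b) (coord3 y)) = hpoint a b (coord3 y).
    by apply: heisP; rewrite !coord_hpoint; field.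
  have -> : profile (hpoint (tau * a) (tau * b) (coord3 y)) t - s =
      m + tau ^+ 4 * (a ^+ 2 + b ^+ 2) ^+ 2 + 12 * t * tau ^+ 2 * (a ^+ 2 + b ^+ 2).
    by rewrite /profile !coord_hpoint mE; ring.
  move=> /drop minT; apply: (le_trans minT); rewrite le_eqVlt; apply/orP; left; apply/eqP; ring.
have [a0 b0] : a = 0 /\ b = 0.
  by move/eqP: n0; rewrite paddr_eq0 ?sqr_ge0// !sqrf_eq0 => /andP[/eqP + /eqP].
have m_ge0 : 0 <= m.
  apply: (horizontal_min t_gt0) => tau.
  have := Jmax tau 0 (hpoint (- tau) 0 (coord3 y)) t t_gt0.
  rewrite JE /J.
  have -> : hmul (hpoint tau 0 0) (hpoint (- tau) 0 (coord3 y)) =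
      hpoint a b (coord3 y).
    by apply: heisP; rewrite !coord_hpoint ?a0 ?b0; field.
  have -> : profile (hpoint (- tau) 0 (coord3 y)) t - s =
      m + tau ^+ 4 + 12 * t * tau ^+ 2.
    by rewrite /profile !coord_hpoint mE; ring.
  rewrite n0 => /drop; rewrite expr0n /= add0r => minT; apply: (le_trans minT).
  by rewrite le_eqVlt; apply/orP; left; apply/eqP; ring.
have m_gt0 : 0 < m by rewrite lt_def m_neq0.
(* Now the horizontal part of [y] is frozen at [0]. On the axis the mixed derivatives of [e] are
   opposite and cancel in the symmetrization, while its time derivative is positive because
   [m > 0]. *)
pose rho := EAdd (EMul (EVar Xa) (EVar Xa)) (@EMul R (EVar Xb) (EVar Xb)).
pose h := EAdd (EMul (ECst 16) (EMul (EVar Xc) (EVar Xc)))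
  (EAdd (EMul (ECst 12) (EMul (EVar Xt) (EVar Xt))) (ECst (- s))).
pose e := EAdd (quartic_test 0 C eps h) (EMul (ECst C) (EMul rho rho)).
have x1 : coord1 x0.1 = 0 by rewrite x0E coord_hpoint.
have x2 : coord2 x0.1 = 0 by rewrite x0E coord_hpoint.
have x3 : coord3 x0.1 = coord3 y by rewrite x0E coord_hpoint.
have [|_ flat] := @vP G e x0 hG t_gt0.
  move=> [p r] r_gt0.
  have := Jmax (coord1 p) (coord2 p) (hpoint 0 0 (coord3 p)) r r_gt0.
  rewrite JE /J.
  have -> : hmul (hpoint (coord1 p) (coord2 p) 0) (hpoint 0 0 (coord3 p)) = p.
    by apply: heisP; rewrite !coord_hpoint; ring.
  have evE x : evalx G e x = C * ((coord1 x.1 ^+ 2 + coord2 x.1 ^+ 2) ^+ 2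
      + (16 * coord3 x.1 ^+ 2 + 12 * x.2 ^+ 2 - s) ^+ 4) + eps * G 0%N x.2.
    by rewrite /=; ring.
  rewrite !evE x1 x2 x3 /= /x0 -[hmul _ _]/(x0.1) x0E /profile !coord_hpoint mE n0.
  rewrite !expr0n /= !addr0 !mulr0 !add0r; lra.
have eps_gt : 0 < eps * G 1%N t by rewrite mulr_gt0 ?G1// ltW.
have t_der : evalx G (der Xt e) x0 = C * m ^+ 3 * (96 * t) + eps * G 1%N t.
  by rewrite mE /= -/x0 -[hmul _ _]/(x0.1) x1 x2 x3; ring.
have := mulr_gt0 (mulr_gt0 C_gt0 (exprn_gt0 3 m_gt0)) (mulr_gt0 (ltr0n R 96) t_gt0).
suff : evalx G (der Xt e) x0 <= 0 by rewrite t_der; lra.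
have x1' : coord1 (hmul (hpoint a b 0) y) = 0 by exact: x1.
have x2' : coord2 (hmul (hpoint a b 0) y) = 0 by exact: x2.
by apply: flat; rewrite /= x1' x2'; ring.
Qed.

End Profile.

(** * Comparison with the explicit solution *)

Section Comparison.
Variable R : realType.
Implicit Types (p y : heis R) (v : spacetime R -> R) (q : 'rV[R]_6).

Lemma compact_box n (L : R) :
  compact [set q : 'rV[R]_n | forall i, `[- L, L]%classic (q ord0 i)].
Proof.
by apply: (@rV_compact R n (fun=> `[- L, L]%classic)) => i; exact: segment_compact.
Qed.

Lemma continuous_pair (T U V : topologicalType) (f : T -> U) (g : T -> V) :
  continuous f -> continuous g -> continuous (fun x => (f x, g x)).
Proof. by move=> fc gc x; exact: (cvg_pair (fc x) (gc x)). Qed.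

Lemma cvg_hpoint (T : Type) (F : set_system T) {FF : Filter F}
    (f g h : T -> R) (a b c : R) :
  f @ F --> a -> g @ F --> b -> h @ F --> c ->
  hpoint (f x) (g x) (h x) @[x --> F] --> hpoint a b c.
Proof.
move=> fa gb hc U [A Anbhs AU].
have coords : \forall z \near F, forall j, A 0 j (hpoint (f z) (g z) (h z) 0 j).
  apply: filter_forall => j; have := Anbhs 0 j; rewrite mxE.
  under eq_near do rewrite mxE.
  by case: j => [[|[|[|//]]] jlt] /= ?; [exact: fa|exact: gb|exact: hc].
by apply: filterS coords => z Az; apply: AU => i j; rewrite ord1.
Qed.

Lemma ler_norm_sqr (x h : R) : 0 <= h -> x ^+ 2 <= h -> `|x| <= 1 + h.
Proof.
move=> h_ge0 xh; rewrite -(ler_sqr) ?nnegrE ?addr_ge0// real_normK ?num_real//.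
by apply: (le_trans xh); nra.
Qed.

(** For [0 <= t] the profile is a sum of nonnegative terms, so the penalty is coercive in all
    variables but time, uniformly in [t]. *)
Lemma doubled_bounds (a b s t h : R) y : 0 <= t -> 0 <= h ->
  (a ^+ 2 + b ^+ 2) ^+ 2 + (profile y t - s) ^+ 4 <= h ->
  let L := `|s| + h + 10 in
  [/\ `|a| <= L, `|b| <= L, `|coord1 y| <= L, `|coord2 y| <= L &
      `|coord3 y| <= L].
Proof.
move=> t_ge0 h_ge0 Hh L.
have s_ge0 : 0 <= `|s| by [].
have sq (x : R) : 0 <= x ^+ 2 by exact: sqr_ge0.
have ab_ge0 : 0 <= a ^+ 2 + b ^+ 2 by rewrite addr_ge0 ?sq.
have rho_ge0 : 0 <= coord1 y ^+ 2 + coord2 y ^+ 2 by rewrite addr_ge0 ?sq.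
have fourth : (profile y t - s) ^+ 4 = ((profile y t - s) ^+ 2) ^+ 2.
  by rewrite -exprM.
have ab_le : a ^+ 2 + b ^+ 2 <= 1 + h.
  rewrite -(ger0_norm ab_ge0); apply: ler_norm_sqr => //.
  by apply: le_trans Hh; rewrite lerDl fourth sq.
have pr_le : (profile y t - s) ^+ 2 <= 1 + h.
  rewrite -(ger0_norm (sq _)); apply: ler_norm_sqr => //.
  by apply: le_trans Hh; rewrite fourth lerDr sq.
have pr_le' : profile y t <= `|s| + h + 2.
  have := ler_norm_sqr (addr_ge0 ler01 h_ge0) pr_le.
  have := ler_norm (profile y t - s); have := ler_norm s; lra.
have trho : 0 <= t * (coord1 y ^+ 2 + coord2 y ^+ 2) by rewrite mulr_ge0.
have rho_le : coord1 y ^+ 2 + coord2 y ^+ 2 <= `|s| + h + 3.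
  rewrite -(ger0_norm rho_ge0).
  suff /ler_norm_sqr : (coord1 y ^+ 2 + coord2 y ^+ 2) ^+ 2 <= `|s| + h + 2.
    by rewrite !addr_ge0// => /(_ isT); lra.
  by have := sq (coord3 y); have := sq t; move: pr_le'; rewrite /profile; lra.
have z_le : coord3 y ^+ 2 <= `|s| + h + 2.
  have := sq (coord1 y ^+ 2 + coord2 y ^+ 2); have := sq t.
  by have := sq (coord3 y); move: pr_le'; rewrite /profile; lra.
have bound x : x ^+ 2 <= `|s| + h + 3 -> `|x| <= L.
  by move=> /ler_norm_sqr; rewrite !addr_ge0// => /(_ isT); rewrite /L; lra.
have := sq a; have := sq b; have := sq (coord1 y); have := sq (coord2 y) => *.
by split; apply: bound; lra.
Qed.


(* A point of ['rV_6] stands for [(a, b, y, t)] with [y] in the Heisenberg group. *)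
Definition dbl_y q : heis R := hpoint (q 0 2%:R) (q 0 3%:R) (q 0 4%:R).
Definition dbl_x q : heis R := hmul (hpoint (q 0 0) (q 0 1) 0) (dbl_y q).
Definition dbl_point (a b : R) y (t : R) : 'rV[R]_6 :=
  \row_(i < 6) [:: a; b; coord1 y; coord2 y; coord3 y; t]`_i.

Definition dbl_gap (s : R) q (t : R) : R :=
  (q 0 0 ^+ 2 + q 0 1 ^+ 2) ^+ 2 + (profile (dbl_y q) t - s) ^+ 4.

Lemma dbl_pointE a b y t : let q := dbl_point a b y t in
  [/\ q 0 0 = a, q 0 1 = b, dbl_y q = y & q 0 5%:R = t].
Proof.
split; rewrite ?mxE//.
by apply: heisP; rewrite !coord_hpoint !mxE.
Qed.

Lemma dbl_gap_ge0 s q t : 0 <= dbl_gap s q t.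
Proof. by rewrite addr_ge0 ?sqr_ge0// exprn_even_ge0. Qed.

Let coord_cont n (i : 'I_n.+1) : continuous (fun q : 'rV[R]_n.+1 => q 0 i).
Proof. exact: coord_continuous. Qed.

Lemma dbl_xE q : dbl_x q = hpoint (q 0 0 + q 0 2%:R) (q 0 1 + q 0 3%:R)
  (0 + q 0 4%:R + 2^-1 * (q 0 0 * q 0 3%:R - q 0 2%:R * q 0 1)).
Proof. by rewrite /dbl_x /hmul /dbl_y !coord_hpoint. Qed.

Lemma dbl_gapE s q t : dbl_gap s q t =
  let rho := q 0 2%:R ^+ 2 + q 0 3%:R ^+ 2 in
  (q 0 0 ^+ 2 + q 0 1 ^+ 2) ^+ 2 +
  (rho ^+ 2 + 12 * t * rho + 16 * q 0 4%:R ^+ 2 + 12 * t ^+ 2 - s) ^+ 4.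
Proof. by rewrite /dbl_gap /profile /dbl_y !coord_hpoint. Qed.

Lemma continuous_dbl_x : continuous dbl_x.
Proof.
rewrite (funext dbl_xE) => q; apply: (@cvg_hpoint _ (nbhs q)).
- by apply: cvgD; exact: coord_cont.
- by apply: cvgD; exact: coord_cont.
- apply: cvgD; first by apply: cvgD; [exact: cvg_cst|exact: coord_cont].
  apply: cvgM; first exact: cvg_cst.
  by apply: cvgB; apply: cvgM; exact: coord_cont.
Qed.

Lemma continuous_dbl_gap s (tau : 'rV[R]_6 -> R) : continuous tau ->
  continuous (fun q => dbl_gap s q (tau q)).
Proof.
move=> tau_cont; under eq_fun do rewrite dbl_gapE.
move=> q /=.
have X n (f : 'rV[R]_6 -> R) (l : R) : f z @[z --> nbhs q] --> l ->
    (f z ^+ n) @[z --> nbhs q] --> l ^+ n.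
  move=> fl; apply: (@cvg_comp _ _ _ f (fun r => r ^+ n) _ _ _ fl).
  exact: exprn_continuous.
have Xc i n : (fun z : 'rV[R]_6 => z 0 i ^+ n) @ nbhs q --> q 0 i ^+ n.
  by apply: X; exact: coord_cont.
have rho_cvg : (fun z : 'rV[R]_6 => z 0 2%:R ^+ 2 + z 0 3%:R ^+ 2) @ nbhs q -->
    q 0 2%:R ^+ 2 + q 0 3%:R ^+ 2 by apply: cvgD; exact: Xc.
apply: (@cvgD _ _ _ (nbhs q)); first by apply: X; apply: cvgD; exact: Xc.
apply: (X 4%N); apply: (@cvgB _ _ _ (nbhs q)); last exact: cvg_cst.
apply: cvgD; last by apply: cvgM; [exact: cvg_cst|apply: X; exact: tau_cont].
apply: cvgD.
  apply: cvgD; first exact: X.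
  by apply: cvgM => //; apply: cvgM; [exact: cvg_cst|exact: tau_cont].
by apply: cvgM; [exact: cvg_cst|exact: Xc].
Qed.

Lemma dbl_gap_bounds s q (t h : R) : 0 <= t -> 0 <= h -> dbl_gap s q t <= h ->
  forall i : 'I_6, i != 5%:R -> `|q 0 i| <= `|s| + h + 10.
Proof.
move=> t_ge0 h_ge0 gap_le.
have [] := doubled_bounds t_ge0 h_ge0 gap_le.
rewrite /dbl_y !coord_hpoint => b0 b1 b2 b3 b4.
move=> i i5; have : i \in [:: 0; 1; 2%:R; 3%:R; 4%:R; 5%:R].
  by case: i {i5} => [[|[|[|[|[|[|//]]]]]] ?].
by rewrite !inE (negPf i5) orbF => /or4P[|||/orP[]] /eqP ->.
Qed.

(** The gap vanishes only when [a = 0] and [profile y 0 = s], where [f < A]. Hence it has a positive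
    minimum on the compact part of the box where [f >= A], and a large [C] compensates there. *)
Lemma initial_bound (f : heis R -> R) (s A M : R) :
  continuous f -> (forall p, f p <= M) ->
  (forall p, profile p 0 = s -> f p < A) ->
  exists2 C, 0 < C & forall a b y,
    f (hmul (hpoint a b 0) y) <=
      A + C * ((a ^+ 2 + b ^+ 2) ^+ 2 + (profile y 0 - s) ^+ 4).
Proof.
move=> f_cont f_le f_lt.
pose L := `|s| + 1 + 10.
pose D := [set q : 'rV[R]_6 | forall i, `[- L, L]%classic (q ord0 i)] `&`
  [set q | A <= f (dbl_x q)].
have D_compact : compact D.
  apply: (subclosed_compact _ (@compact_box 6 L)); last by move=> q [].
  apply: closedI.
    by apply: compact_closed; [exact: norm_hausdorff|exact: compact_box].
  apply: (@preimage_closed _ _ (fun q => f (dbl_x q)) [set r | A <= r]).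
    move=> q _; apply: (@continuous_comp _ _ _ dbl_x f); first exact: continuous_dbl_x.
    exact: f_cont.
  exact: closed_ge.
have gap_cont : continuous (fun q => dbl_gap s q 0).
  by apply: (@continuous_dbl_gap s (fun=> 0)); exact: cst_continuous.
have [h h_gt0 h_le] : exists2 h : R, 0 < h &
    forall q, D q -> h <= dbl_gap s q 0.
  have [D_neq0|D_eq0] := pselect (D !=set0); last first.
    by exists 1 => // q Dq; exfalso; apply: D_eq0; exists q.
  have [c cD cmin] := compact_EVT_min D_neq0 D_compact (continuous_subspaceT gap_cont).
  exists (dbl_gap s c 0); last by move=> q Dq; apply: cmin; rewrite inE.
  rewrite lt_def dbl_gap_ge0 andbT; apply/eqP => gap0.
  have [_ ] : D c by rewrite inE in cD.
  apply/negP; rewrite -ltNge /=; move/eqP: gap0.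
  rewrite paddr_eq0 ?sqr_ge0 ?exprn_even_ge0// sqrf_eq0 expf_eq0 subr_eq0 /=.
  rewrite paddr_eq0 ?sqr_ge0// !sqrf_eq0 => /andP[/andP[/eqP c0 /eqP c1] /eqP cs].
  have -> : dbl_x c = dbl_y c.
    by rewrite /dbl_x c0 c1; apply: heisP; rewrite !coord_hpoint; ring.
  exact: f_lt.
(* A point with gap at most [1] lies in the box, so the gap is at least [h'] wherever [f >= A]. *)
pose h' := Num.min 1 h; have h'_gt0 : 0 < h' by rewrite lt_min ltr01.
have MA_gt0 : 0 < `|M| + `|A| + 1 by rewrite ltr_wpDl// addr_ge0.
exists ((`|M| + `|A| + 1) / h'); first by rewrite divr_gt0.
move=> a b y.
have [q0 q1 qy _] := dbl_pointE a b y 0.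
set q := dbl_point a b y 0 in q0 q1 qy.
have -> : (a ^+ 2 + b ^+ 2) ^+ 2 + (profile y 0 - s) ^+ 4 = dbl_gap s q 0.
  by rewrite /dbl_gap q0 q1 qy.
have -> : hmul (hpoint a b 0) y = dbl_x q by rewrite /dbl_x q0 q1 qy.
set C := _ / _; have C_gt0 : 0 < C by rewrite divr_gt0.
have [f_lt_A|f_ge_A] := ltP (f (dbl_x q)) A.
  by rewrite (le_trans (ltW f_lt_A))// lerDl mulr_ge0 ?dbl_gap_ge0// ltW.
have gap_ge : h' <= dbl_gap s q 0.
  have [gap1|] := leP (dbl_gap s q 0) 1; last first.
    by move=> /ltW; apply: le_trans; rewrite ge_min lexx.
  apply: (@le_trans _ _ h); first by rewrite ge_min lexx orbT.
  apply: h_le; split => // i /=; rewrite in_itv /= -ler_norml.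
  have [->|i5] := eqVneq i 5%:R; last exact: (dbl_gap_bounds _ _ gap1).
  by rewrite mxE normr0 !addr_ge0.
apply: (le_trans (f_le _)).
have : C * h' <= C * dbl_gap s q 0 by rewrite ler_wpM2l// ltW.
rewrite divfK ?gt_eqF//; have := ler_norm M; have := ler_norm (- A).
rewrite normrN; lra.
Qed.

Lemma comparison v (s A : R) :
  passes_tests v ->
  {within [set x : spacetime R | 0 <= x.2], continuous v} ->
  (forall T : R, exists M : R, forall p t, 0 <= t <= T -> v (p, t) <= M) ->
  (forall p, profile p 0 = s -> v (p, 0) < A) ->
  forall p t, 0 <= t -> profile p t = s -> v (p, t) <= A.
Proof.
move=> v_tests v_cont v_bounded v_init p1 t1 t1_ge0 pt1; rewrite leNgt; apply/negP => vA.
(* Reflection in time makes [w] continuous everywhere without changing [v] for [0 <= t]. *)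
pose w (x : spacetime R) := v (x.1, `|x.2|).
have w_cont : continuous w.
  move=> x; pose g (x : spacetime R) : spacetime R := (x.1, `|x.2|).
  have g_cvg : {for x, continuous g}.
    apply: continuous_pair => {}x; first exact: cvg_fst.
    by apply: (@cvg_norm _ R _ (nbhs x) _ snd); exact: cvg_snd.
  have /subspace_continuousP/(_ (g x) (normr_ge0 _)) vg := v_cont.
  move=> U /vg /= vU; have := g_cvg _ vU.
  by apply: (@filterS _ (nbhs x)) => z /=; apply; exact: normr_ge0.
have wE p t : 0 <= t -> w (p, t) = v (p, t) by move=> t_ge0; rewrite /w /= ger0_norm.
have w0_cont : continuous (fun p => w (p, 0)).
  move=> p; apply: (@continuous_comp _ _ _ (fun p => (p, 0)) w); last exact: w_cont.
  by apply: continuous_pair => [?|]; [exact: cvg_id|exact: cst_continuous].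
have [M0 w0_le] : exists M, forall p, w (p, 0) <= M.
  have [M vM] := v_bounded 0; exists M => p; rewrite wE//; apply: vM.
  by rewrite lexx.
have [|C C_gt0 w_le] := initial_bound w0_cont w0_le (s := s) (A := A).
  by move=> p ps; rewrite wE//; exact: v_init.
(* [M n] reaches up to [n + 4] because it is used for [n + 3 <= t < n + 4], where [G 0] already
   exceeds [n (M n + 1)]. *)
have /choice[M vM] : forall n : nat, exists M : R, 0 <= M /\
    forall p t, 0 <= t <= (n + 4)%:R -> v (p, t) <= M.
  move=> n; have [M vM] := v_bounded (n + 4)%:R; exists `|M|; split=> // p t tn.
  by rewrite (le_trans (vM p t tn))// ler_norm.
have [G [hG G0_ge0 G1_gt0 G_ge]] := smooth_majorant (fun n => n%:R * (M n + 1)).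
pose delta := v (p1, t1) - A; have delta_gt0 : 0 < delta by rewrite subr_gt0.
pose eps := delta / (2 * (G 0%N t1 + 1)).
have Gt1 := G0_ge0 _ t1_ge0.
have den_gt0 : 0 < 2 * (G 0%N t1 + 1) by lra.
have eps_gt0 : 0 < eps by rewrite divr_gt0.
have eps_small : eps * G 0%N t1 < delta.
  have : eps * (2 * (G 0%N t1 + 1)) = delta by rewrite /eps divfK ?gt_eqF.
  have := mulr_ge0 (ltW eps_gt0) Gt1; lra.
(* For [n >= n0] the time penalty on [[n + 3, n + 4)] is at least [(1 + |A|) (M n + 1)], which
   outweighs [v - A]. *)
pose n0 := Num.bound ((1 + `|A|) / eps).
have n0_ge : 1 + `|A| <= eps * n0%:R.
  rewrite mulrC -ler_pdivrMr// ltW//; apply: archi_boundP.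
  by rewrite divr_ge0 ?addr_ge0// ltW.
pose J q := w (dbl_x q, q 0 5%:R) - A - C * dbl_gap s q (q 0 5%:R)
  - eps * G 0%N (q 0 5%:R).
have J_late q : (n0 + 3)%:R <= q 0 5%:R -> J q <= 0.
  set t := q 0 5%:R => t_ge; have t_ge0 : 0 <= t by apply: le_trans t_ge.
  have /andP[tn tn1] := truncn_itv t_ge0.
  have n_ge : (n0 + 3 <= Num.trunc t)%N.
    by rewrite -ltnS -(ltr_nat R) (le_lt_trans t_ge).
  pose n := (Num.trunc t - 3)%N.
  have nE : Num.trunc t = (n + 3)%N.
    by rewrite subnK// (leq_trans _ n_ge)// leq_addl.
  rewrite nE in tn tn1.
  have n0n : (n0 <= n)%N.
    by rewrite leq_subRL ?(leq_trans _ n_ge) ?leq_addl// addnC.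
  have [Mn_ge0 vMn] := vM n.
  have v_le : v (dbl_x q, t) <= M n by apply: vMn; rewrite t_ge0 addnS ltW.
  have epsn : 1 + `|A| <= eps * n%:R.
    by apply: (le_trans n0_ge); rewrite ler_pM2l// ler_nat.
  have epsG : eps * (n%:R * (M n + 1)) <= eps * G 0%N t by rewrite ler_pM2l// G_ge.
  have : (1 + `|A|) * (M n + 1) <= eps * n%:R * (M n + 1).
    by rewrite ler_wpM2r// addr_ge0.
  have := mulr_ge0 (normr_ge0 A) Mn_ge0; have := ler_norm (- A).
  have := mulr_ge0 (ltW C_gt0) (dbl_gap_ge0 s q t).
  rewrite /J -/t wE// normrN; lra.
(* Where the gap exceeds [h0], the term [C gap] alone outweighs [v - A] before time [n0 + 3]. *)
pose h0 := (M n0 + `|A|) / C.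
have h0_ge0 : 0 <= h0 by rewrite divr_ge0 ?addr_ge0// ?(vM n0).1// ltW.
have J_far q : 0 <= q 0 5%:R -> h0 < dbl_gap s q (q 0 5%:R) -> J q <= 0.
  set t := q 0 5%:R => t_ge0 gap_gt.
  have [late|early] := leP (n0 + 3)%:R t; first exact: J_late.
  have v_le : v (dbl_x q, t) <= M n0.
    by apply: (vM n0).2; rewrite t_ge0 (le_trans (ltW early))// ler_nat leq_add2l.
  have : C * h0 <= C * dbl_gap s q t by rewrite ler_pM2l// ltW.
  rewrite /h0 mulrCA divff ?gt_eqF// mulr1 => gapC.
  have := ler_norm (- A); have := mulr_ge0 (ltW eps_gt0) (G0_ge0 _ t_ge0).
  rewrite /J -/t wE// normrN; lra.
have J_init q : q 0 5%:R = 0 -> J q <= 0.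
  move=> t0; rewrite /J t0.
  have := w_le (q 0 0) (q 0 1) (dbl_y q).
  have := mulr_ge0 (ltW eps_gt0) (G0_ge0 _ (lexx 0)).
  rewrite -/(dbl_x q) /dbl_gap; lra.
pose L := `|s| + h0 + 10 + (n0 + 3)%:R.
pose D := [set q : 'rV[R]_6 | forall i, `[- L, L]%classic (q ord0 i)] `&`
  [set q : 'rV[R]_6 | 0 <= q 0 5%:R].
have D_compact : compact D.
  apply: (subclosed_compact _ (@compact_box 6 L)); last by move=> q [].
  apply: closedI.
    by apply: compact_closed; [exact: norm_hausdorff|exact: compact_box].
  apply: (@preimage_closed _ _ (fun q : 'rV[R]_6 => q 0 5%:R) [set r | 0 <= r]).
    by move=> q _; exact: coord_cont.
  exact: closed_ge.
have J_cont : continuous J.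
  move=> q; apply: (@cvgB _ _ _ (nbhs q)); last first.
    apply: (@cvgM _ _ (nbhs q)); first exact: cvg_cst.
    apply: (@continuous_comp _ _ _ (fun q : 'rV[R]_6 => q 0 5%:R) (G 0%N)).
      exact: coord_cont.
    exact/differentiable_continuous/derivable1_diffP/(@ex_derive _ _ _ _ _ _ _ (hG _ _)).
  apply: (@cvgB _ _ _ (nbhs q)).
    apply: (@cvgB _ _ _ (nbhs q)); last exact: cvg_cst.
    apply: (@continuous_comp _ _ _ (fun q : 'rV[R]_6 => (dbl_x q, q 0 5%:R)) w).
      by apply: continuous_pair; [exact: continuous_dbl_x|exact: coord_cont].
    exact: w_cont.
  apply: (@cvgM _ _ (nbhs q)); first exact: cvg_cst.
  by apply: continuous_dbl_gap; exact: coord_cont.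
have J_out q : 0 <= q 0 5%:R -> ~ D q -> J q <= 0.
  move=> t_ge0 nDq.
  have [late|early] := leP (n0 + 3)%:R (q 0 5%:R); first exact: J_late.
  have [gap_le|gap_gt] := leP (dbl_gap s q (q 0 5%:R)) h0; last exact: J_far.
  exfalso; apply: nDq; split => // i /=; rewrite in_itv /= -ler_norml.
  have [->|i5] := eqVneq i 5%:R.
    by rewrite ger0_norm// (le_trans (ltW early))// lerDr !addr_ge0.
  by rewrite (le_trans (dbl_gap_bounds t_ge0 h0_ge0 gap_le i5))// lerDl.
pose q1 := dbl_point 0 0 p1 t1.
have [q1_0 q1_1 q1_y q1_t] := dbl_pointE 0 0 p1 t1.
have J_q1 : 0 < J q1.
  rewrite /J q1_t /dbl_gap /dbl_x q1_0 q1_1 q1_y pt1 subrr wE//.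
  have -> : hmul (hpoint 0 0 0) p1 = p1.
    by apply: heisP; rewrite !coord_hpoint; ring.
  by rewrite !expr0n /= !(addr0, mulr0) expr0n /= mulr0 subr0 -/delta subr_gt0.
have D_q1 : D q1.
  apply: contrapT => nD; have := J_out q1; rewrite q1_t => /(_ t1_ge0 nD).
  by rewrite leNgt J_q1.
(* [J] is positive at [q1] but nonpositive off [D] and at time [0], so its maximum over [D] is
   global and lies at a positive time. *)
have [c cD cmax] := compact_EVT_max (ex_intro _ q1 D_q1) D_compact
  (continuous_subspaceT J_cont).
have J_c : 0 < J c by apply: (lt_le_trans J_q1); apply: cmax; rewrite inE.
have c_t_ge0 : 0 <= c 0 5%:R by move: cD; rewrite inE => -[].
have c_t : 0 < c 0 5%:R.
  rewrite lt_def c_t_ge0 andbT; apply/eqP => /J_init.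
  by rewrite leNgt J_c.
apply: (@no_doubled_max _ v C eps s G (c 0 0) (c 0 1) (c 0 5%:R) (dbl_y c)) => //.
move=> a b y t t_gt0.
have [q0 qb qy qt] := dbl_pointE a b y t.
have : J (dbl_point a b y t) <= J c.
  have [Dq|nDq] := pselect (D (dbl_point a b y t)); first by apply: cmax; rewrite inE.
  by apply: le_trans (ltW J_c); apply: J_out => //; rewrite qt ltW.
rewrite /J /dbl_gap /dbl_x q0 qb qy qt !wE// ?(ltW t_gt0)//; lra.
Qed.

End Comparison.

(** * The flow of a sphere *)

Section LevelSets.
Variable R : realType.
Implicit Types (p : heis R) (f : heis R -> R) (u : spacetime R -> R).

Lemma profile_ge0 p (t : R) : 0 <= t -> 0 <= profile p t.
Proof.
move=> t_ge0; rewrite /profile.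
have rho_ge0 : 0 <= coord1 p ^+ 2 + coord2 p ^+ 2 by rewrite addr_ge0 ?sqr_ge0.
have := mulr_ge0 t_ge0 rho_ge0; have := sqr_ge0 (coord1 p ^+ 2 + coord2 p ^+ 2).
by have := sqr_ge0 (coord3 p); have := sqr_ge0 t; lra.
Qed.

Lemma koranyi_eq p (r : R) : 0 < r -> koranyi p = r <-> profile p 0 = r ^+ 4.
Proof.
move=> r_gt0; have k_ge0 : 0 <= koranyi p by exact: powR_ge0.
have <- : koranyi p ^+ 4 = profile p 0.
  rewrite -powR_mulrn// /koranyi -powRrM mulVf ?pnatr_eq0// powRr1.
    by rewrite /profile; ring.
  by rewrite addr_ge0 ?sqr_ge0// mulr_ge0 ?sqr_ge0.
split=> [->//|/eqP]; rewrite eqrXn2 ?(ltW r_gt0)//.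
by move/eqP.
Qed.

Lemma bounded_flow u (T : R) :
  {within [set x : spacetime R | 0 <= x.2], continuous u} ->
  (forall T' : R, 0 < T' -> exists (K : set (heis R)) (c : R), compact K /\
     forall p t, ~ K p -> 0 <= t <= T' -> u (p, t) = c) ->
  exists M : R, forall p t, 0 <= t <= T -> `|u (p, t)| <= M.
Proof.
move=> u_cont u_const; pose T' : R := `|T| + 1.
have [K [c [K_compact uc]]] := u_const T' (ltr_wpDl (normr_ge0 _) ltr01).
pose A : set (spacetime R) := K `*` `[0, T'].
have A_compact : compact A by apply: compact_setX => //; exact: segment_compact.
have u_A : {within A, continuous u}.
  apply: continuous_subspaceW u_cont => -[p t] [_] /=.
  by rewrite in_itv /= => /andP[].
have [M [_ uM]] := compact_bounded (continuous_compact u_A A_compact).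
exists (Num.max (`|M| + 1) `|c|) => p t /andP[t_ge0 tT].
have tT' : 0 <= t <= T'.
  by rewrite t_ge0 (le_trans tT)// (le_trans (ler_norm T))// lerDl.
rewrite le_max; have [Kp|nKp] := pselect (K p); last by rewrite (uc p t)// lexx orbT.
apply/orP; left; apply: (uM (`|M| + 1)).
  by rewrite (le_lt_trans (ler_norm _))// ltrDl.
by exists (p, t) => //; split => //=; rewrite in_itv.
Qed.

(* By axisymmetry [f] factors on the sphere through the arc of its points with
   vanishing second and nonnegative first coordinate, to which the intermediate
   value theorem applies. *)
Lemma sign_on_sphere f (s : R) :
  continuous f -> axisymmetric f -> 0 <= s ->
  (forall p, profile p 0 = s -> f p != 0) ->
  (exists2 A, A < 0 & forall p, profile p 0 = s -> f p < A) \/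
  (exists2 A, 0 < A & forall p, profile p 0 = s -> A < f p).
Proof.
move=> f_cont f_axi s_ge0 f_neq0.
(* The iterated square root solves [rho ^ 2 + 16 z ^ 2 = s] for the radius; [zeta] below is the
   height of the poles. *)
pose arc (z : R) : heis R := hpoint (Num.sqrt (Num.sqrt (s - 16 * z ^+ 2))) 0 z.
pose zeta := Num.sqrt s / 4; have zeta_ge0 : 0 <= zeta by rewrite divr_ge0 ?sqrtr_ge0.
have zetaE : 16 * zeta ^+ 2 = s by rewrite /zeta expr_div_n sqr_sqrtr//; field.
have g_cont : continuous (f \o arc).
  move=> z; apply: continuous_comp; last exact: f_cont.
  apply: (@cvg_hpoint _ _ (nbhs z)); [|exact: cvg_cst|exact: cvg_id].
  apply: (@cvg_comp _ _ _ (fun z => Num.sqrt (s - 16 * z ^+ 2)) Num.sqrt _ _ _ _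
    (@sqrt_continuous R _)).
  apply: (@cvg_comp _ _ _ (fun z => s - 16 * z ^+ 2) Num.sqrt _ _ _ _
    (@sqrt_continuous R _)).
  apply: (@cvgB _ _ _ (nbhs z)); first exact: cvg_cst.
  by apply: (@cvgM _ _ (nbhs z)); [exact: cvg_cst|exact: exprn_continuous].
have arc_sphere z : z \in `[- zeta, zeta] -> profile (arc z) 0 = s.
  rewrite in_itv /= -ler_norml => z_le.
  have z2 : 16 * z ^+ 2 <= s.
    by rewrite -zetaE ler_pM2l// -[z ^+ 2]real_normK ?num_real// lerXn2r ?nnegrE.
  rewrite /profile /arc !coord_hpoint sqr_sqrtr ?sqrtr_ge0// expr0n /= addr0.
  by rewrite sqr_sqrtr ?subr_ge0//; ring.
have on_arc p : profile p 0 = s ->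
    coord3 p \in `[- zeta, zeta] /\ f p = f (arc (coord3 p)).
  rewrite /profile => ps.
  have rho_ge0 : 0 <= coord1 p ^+ 2 + coord2 p ^+ 2 by rewrite addr_ge0 ?sqr_ge0.
  have rho2 : (coord1 p ^+ 2 + coord2 p ^+ 2) ^+ 2 = s - 16 * coord3 p ^+ 2.
    by rewrite -ps; ring.
  have z_le : 16 * coord3 p ^+ 2 <= 16 * zeta ^+ 2.
    by rewrite zetaE -subr_ge0 -rho2 sqr_ge0.
  split.
    rewrite in_itv /= -ler_norml -ler_sqr ?nnegrE// real_normK ?num_real//.
    by rewrite ler_pM2l in z_le.
  apply: f_axi; split; rewrite !coord_hpoint// sqr_sqrtr ?sqrtr_ge0//.
  by rewrite -rho2 sqrtr_sqr ger0_norm// expr0n addr0.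
have g_sub a b : {within `[a, b], continuous (f \o arc)}.
  exact: continuous_subspaceT.
have le_zeta : - zeta <= zeta by rewrite ge0_cp.
have [a a_in g_max] := EVT_max le_zeta (g_sub _ _).
have [b b_in g_min] := EVT_min le_zeta (g_sub _ _).
have [ga_lt0|ga_gt0|ga0] := ltgtP (f (arc a)) 0; last first.
- by have := f_neq0 _ (arc_sphere a a_in); rewrite ga0 eqxx.
- have [gb_lt0|gb_gt0|gb0] := ltgtP (f (arc b)) 0; last first.
  + by have := f_neq0 _ (arc_sphere b b_in); rewrite gb0 eqxx.
  + right; exists (f (arc b) / 2); first by rewrite divr_gt0.
    move=> p /on_arc[z_in ->]; apply: (lt_le_trans _ (g_min _ z_in)) => /=; lra.
  + have zero x y : x <= y -> x \in `[- zeta, zeta] -> y \in `[- zeta, zeta] ->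
        Num.min (f (arc x)) (f (arc y)) <= 0 <= Num.max (f (arc x)) (f (arc y)) -> False.
      move=> xy; rewrite !in_itv /= => /andP[zx _] /andP[_ yz].
      move=> /(IVT xy (g_sub _ _))[c]; rewrite in_itv /= => /andP[xc cy] /= gc.
      have /arc_sphere/f_neq0 : c \in `[- zeta, zeta].
        by rewrite in_itv /= (le_trans zx)// (le_trans cy).
      by rewrite gc eqxx.
    exfalso; have [ab|/ltW ba] := leP a b.
      by apply: (zero a b) => //; rewrite ge_min le_max (ltW gb_lt0) (ltW ga_gt0) orbT.
    by apply: (zero b a) => //; rewrite ge_min le_max (ltW gb_lt0) (ltW ga_gt0) orbT.
- left; exists (f (arc a) / 2); first by rewrite ltr_pdivrMr// mul0r.
  move=> p /on_arc[z_in ->]; apply: (le_lt_trans (g_max _ z_in)) => /=; lra.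
Qed.

(** If [profile p t] differs from [r ^ 4], then [u0] has a strict sign on the initial level set of
    that value, and comparison carries it to [(p, t)]. On the level [r ^ 4], comparison with [e] and
    [- e] for all [e > 0] gives [u = 0]. *)
Lemma flow_level_set (r : R) (Gamma : R -> set (heis R)) : 0 < r ->
  horizontal_mcf [set p : heis R | koranyi p = r] Gamma ->
  forall t, 0 <= t -> Gamma t = [set p | profile p t = r ^+ 4].
Proof.
move=> r_gt0 [_ _ [u0 [u [u0_cont u0_axi _ u0_zero [flow GammaE]]]]] t t_ge0.
have [u_cont _ u_init [u_sub u_super] u_const] := flow.
have u0P p : u0 p = 0 <-> profile p 0 = r ^+ 4.
  by rewrite -(koranyi_eq p r_gt0) -[u0 p = 0]/([set q | u0 q = 0] p) -u0_zero.
have above s A : (forall p, profile p 0 = s -> u0 p < A) ->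
    forall p, profile p t = s -> u (p, t) <= A.
  move=> u0A p; apply: (comparison (subsolution_passes_tests u_sub)) => //.
    move=> T; have [M uM] := bounded_flow T u_cont u_const.
    by exists M => q t' tT; rewrite (le_trans _ (uM q t' tT))// ler_norm.
  by move=> q; rewrite u_init; exact: u0A.
have below s A : (forall p, profile p 0 = s -> A < u0 p) ->
    forall p, profile p t = s -> A <= u (p, t).
  move=> u0A p ps; rewrite -lerN2.
  apply: (comparison (supersolution_passes_tests u_super)) ps => //.
  - by move=> x; apply: continuousN; exact: u_cont.
  - move=> T; have [M uM] := bounded_flow T u_cont u_const.
    by exists M => q t' tT; rewrite (le_trans _ (uM q t' tT))// -normrN ler_norm.
  - by move=> q qs; rewrite u_init ltrN2; exact: u0A.
rewrite GammaE//; apply/seteqP; split => p /=.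
  move=> up0; apply: contrapT => pr.
  have [|[A A_lt0 u0A]|[A A_gt0 u0A]] :=
      @sign_on_sphere u0 (profile p t) u0_cont u0_axi (profile_ge0 p t_ge0).
  - by move=> q qp; apply/eqP => /u0P; rewrite qp.
  - by have := above _ _ u0A p erefl; rewrite up0 leNgt A_lt0.
  - by have := below _ _ u0A p erefl; rewrite up0 leNgt A_gt0.
move=> pr; apply/eqP; rewrite eq_le; apply/andP; split.
  apply/ler_addgt0Pr => e e_gt0; rewrite add0r.
  by apply: (above (r ^+ 4)) => // q /u0P ->.
apply/ler_addgt0Pl => e e_gt0; rewrite -lerBlDl sub0r.
by apply: (below (r ^+ 4)) => // q /u0P ->; rewrite oppr_lt0.
Qed.

End LevelSets.

(** * Extinction time and rescaled limit *)

Section Extinction.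
Variables (R : realType) (r : R).
Hypothesis r_gt0 : 0 < r.
Let T : R := r ^+ 2 / Num.sqrt 12.

Lemma extinction_gt0 : 0 < T.
Proof. by rewrite divr_gt0 ?exprn_gt0 ?sqrtr_gt0. Qed.

Lemma extinction_sqr : 12 * T ^+ 2 = r ^+ 4.
Proof. by rewrite /T expr_div_n sqr_sqrtr//; field. Qed.

Lemma lt_extinction (t : R) : 0 <= t -> (t < T) = (0 < r ^+ 4 - 12 * t ^+ 2).
Proof.
move=> t_ge0; rewrite subr_gt0 -extinction_sqr ltr_pM2l//.
by rewrite ltr_pXn2r ?nnegrE// ltW// extinction_gt0.
Qed.

Lemma le_extinction (t : R) : 0 <= t -> (t <= T) = (0 <= r ^+ 4 - 12 * t ^+ 2).
Proof.
move=> t_ge0; rewrite subr_ge0 -extinction_sqr ler_pM2l//.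
by rewrite ler_pXn2r ?nnegrE// ltW// extinction_gt0.
Qed.

(** With [l ^ 2 = r ^ 4 - 12 t ^ 2] this is [(profile (l P) t - 12 t ^ 2) / l ^ 2], written without
    the division so that it still makes sense at [t = T]. *)
Definition normalized_profile (P : heis R) (t : R) : R :=
  let rho := coord1 P ^+ 2 + coord2 P ^+ 2 in
  (r ^+ 4 - 12 * t ^+ 2) * rho ^+ 2 + 12 * t * rho + 16 * coord3 P ^+ 2.

Lemma normalized_level_set (P : heis R) (t : R) : 0 <= t < T ->
  scale_set (Num.sqrt (r ^+ 4 - 12 * t ^+ 2)) [set p | profile p t = r ^+ 4] P <->
  normalized_profile P t = 1.
Proof.
move=> /andP[t_ge0]; rewrite lt_extinction// => d_gt0.
set l := Num.sqrt _; have l_gt0 : 0 < l by rewrite sqrtr_gt0.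
have l2 : l ^+ 2 = r ^+ 4 - 12 * t ^+ 2 by rewrite sqr_sqrtr// ltW.
have profileE P' : profile (l *: P') t =
    l ^+ 2 * (normalized_profile P' t - 1) + r ^+ 4.
  have -> : r ^+ 4 = l ^+ 2 + 12 * t ^+ 2 by rewrite l2 subrK.
  rewrite /profile /normalized_profile -l2 /coord1 /coord2 /coord3 !mxE.
  by ring.
split=> [[p pr <-]|P1].
  have : profile (l *: (l^-1 *: p)) t = r ^+ 4.
    by rewrite scalerA divff ?gt_eqF// scale1r.
  rewrite profileE => /eqP; rewrite -subr_eq0 addrK mulf_eq0 expf_eq0 /=.
  by rewrite gt_eqF//= subr_eq0 => /eqP.
exists (l *: P); last by rewrite scalerA mulVf ?gt_eqF// scale1r.
by rewrite /= profileE P1 subrr mulr0 add0r.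
Qed.

Lemma continuous_normalized_profile :
  continuous (fun x : spacetime R => normalized_profile x.1 x.2).
Proof.
pose x1 := @EVar R Xa; pose x2 := @EVar R Xb; pose x3 := @EVar R Xc.
pose t := @EVar R Xt; pose c := @ECst R.
pose rho := EAdd (EMul x1 x1) (EMul x2 x2).
pose e := EAdd (EMul (EAdd (c (r ^+ 4)) (EMul (c (- 12)) (EMul t t))) (EMul rho rho))
  (EAdd (EMul (c 12) (EMul t rho)) (EMul (c 16) (EMul x3 x3))).
have G0 : derivative_chain (fun _ _ => 0 : R) by move=> n s; exact: is_derive_cst.
rewrite (_ : (fun _ => _) = evalx (fun _ _ => 0) e); first exact: continuous_eval.
by apply/funext => x; rewrite /normalized_profile /=; ring.
Qed.

Lemma normalized_limit (t : nat -> R) (P : nat -> heis R) (Q : heis R) :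
  (forall j, normalized_profile (P j) (t j) = 1) ->
  t j @[j --> \oo] --> T -> P j @[j --> \oo] --> Q ->
  normalized_profile Q T = 1.
Proof.
move=> P1 tT PQ.
have PtQ : (P j, t j) @[j --> \oo] --> (Q, T).
  exact: (cvg_pair PQ tT).
have lim := cvg_comp _ _ PtQ (@continuous_normalized_profile (Q, T)).
have cst1 : normalized_profile (P j) (t j) @[j --> \oo] --> (1 : R).
  by rewrite (funext P1); exact: cvg_cst.
exact: (cvg_unique (@norm_hausdorff _ _) lim cst1).
Qed.

(* The dilation factor [k] solves the quadratic equation [a k^4 + b k^2 = 1], with
   [a], [b] the quartic and quadratic parts of [normalized_profile Q t]; it is
   written so that it stays regular when [a] vanishes. *)
Lemma normalized_approximation (Q : heis R) : normalized_profile Q T = 1 ->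
  exists P : R -> heis R,
    (forall t, 0 <= t < T -> normalized_profile (P t) t = 1) /\
    P t @[t --> T^'-] --> Q.
Proof.
set rho := coord1 Q ^+ 2 + coord2 Q ^+ 2; set z := coord3 Q => Q1.
have rho_ge0 : 0 <= rho by rewrite addr_ge0 ?sqr_ge0.
have {}Q1 : 12 * T * rho + 16 * z ^+ 2 = 1.
  by move: Q1; rewrite /normalized_profile -extinction_sqr subrr mul0r add0r.
pose a t := (r ^+ 4 - 12 * t ^+ 2) * rho ^+ 2.
pose b t := 12 * t * rho + 16 * z ^+ 2.
pose D t := b t + Num.sqrt (b t ^+ 2 + 4 * a t).
pose k t := Num.sqrt (2 / D t).
exists (fun t => hpoint (k t * coord1 Q) (k t * coord2 Q) (k t * z)); split.
  move=> t /andP[t_ge0]; rewrite lt_extinction// => d_gt0.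
  have b_ge0 : 0 <= b t.
    by have := mulr_ge0 t_ge0 rho_ge0; have := sqr_ge0 z; rewrite /b; lra.
  have a_ge0 : 0 <= a t by rewrite mulr_ge0 ?sqr_ge0// ltW.
  (* [b] vanishes when [t = 0] and [z = 0]; positivity then comes from [a]. *)
  have disc_gt0 : 0 < b t ^+ 2 + 4 * a t.
    have [rho0|rho_neq0] := eqVneq rho 0.
      have b1 : b t = 1 by move: Q1; rewrite /b rho0 !mulr0.
      by rewrite b1 expr1n; lra.
    have a_gt0 : 0 < a t by rewrite mulr_gt0// exprn_even_gt0.
    by have := sqr_ge0 (b t); lra.
  have D_gt0 : 0 < D t by rewrite ltr_wpDl ?sqrtr_gt0.
  have k2 : k t ^+ 2 * D t = 2.
    by rewrite sqr_sqrtr ?divr_ge0 ?(ltW D_gt0)// divfK ?gt_eqF.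
  have D2 : D t ^+ 2 = 2 * b t * D t + 4 * a t.
    have : (D t - b t) ^+ 2 = b t ^+ 2 + 4 * a t.
      by rewrite /D addrAC subrr add0r sqr_sqrtr// ltW.
    rewrite sqrrB; lra.
  rewrite /normalized_profile !coord_hpoint.
  have -> : (r ^+ 4 - 12 * t ^+ 2) * ((k t * coord1 Q) ^+ 2 + (k t * coord2 Q) ^+ 2) ^+ 2
      + 12 * t * ((k t * coord1 Q) ^+ 2 + (k t * coord2 Q) ^+ 2)
      + 16 * (k t * z) ^+ 2 = a t * (k t ^+ 2) ^+ 2 + b t * k t ^+ 2.
    by rewrite /a /b /rho; ring.
  apply: (@mulfI _ (D t ^+ 2)); first by rewrite expf_neq0 ?gt_eqF.
  have -> : D t ^+ 2 * (a t * (k t ^+ 2) ^+ 2 + b t * k t ^+ 2) =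
      a t * (k t ^+ 2 * D t) ^+ 2 + b t * D t * (k t ^+ 2 * D t) by ring.
  by rewrite k2 D2; ring.
have id_cvg : t @[t --> T^'-] --> T by exact: (cvg_at_left_filter (@cvg_id _ _)).
have sq_cvg (f : R -> R) (l : R) : f t @[t --> T^'-] --> l ->
    f t ^+ 2 @[t --> T^'-] --> l ^+ 2.
  by move=> fl; apply: (@cvg_comp _ _ _ f (fun s => s ^+ 2) _ _ _ fl); exact: exprn_continuous.
have sqrt_cvg (f : R -> R) (l : R) : f t @[t --> T^'-] --> l ->
    Num.sqrt (f t) @[t --> T^'-] --> Num.sqrt l.
  by move=> fl; apply: (@cvg_comp _ _ _ f Num.sqrt _ _ _ fl); exact: sqrt_continuous.
have b_cvg : b t @[t --> T^'-] --> b T.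
  apply: cvgD; last exact: cvg_cst.
  by apply: cvgM; last exact: cvg_cst; apply: cvgM; first exact: cvg_cst.
have a_cvg : a t @[t --> T^'-] --> a T.
  apply: cvgM; last exact: cvg_cst.
  apply: cvgB; first exact: cvg_cst.
  by apply: cvgM; [exact: cvg_cst|exact: sq_cvg].
have bT : b T = 1 by exact: Q1.
have aT : a T = 0 by rewrite /a -extinction_sqr subrr mul0r.
have DT : D T = 2 by rewrite /D aT bT mulr0 addr0 expr1n sqrtr1.
have D_cvg : D t @[t --> T^'-] --> D T.
  apply: cvgD => //; apply: sqrt_cvg; apply: cvgD; first exact: sq_cvg.
  by apply: cvgM => //; exact: cvg_cst.
have frac_cvg : 2 / D t @[t --> T^'-] --> 2 / D T.
  by apply: cvgM; [exact: cvg_cst|apply: cvgV => //; rewrite DT].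
have k_cvg : k t @[t --> T^'-] --> (1 : R).
  have := sqrt_cvg _ _ frac_cvg; rewrite DT divff//.
  by rewrite sqrtr1.
rewrite [X in _ --> X](_ : Q = hpoint (1 * coord1 Q) (1 * coord2 Q) (1 * z)); last first.
  by apply: heisP; rewrite !coord_hpoint mul1r.
by apply: cvg_hpoint; apply: cvgM => //; exact: cvg_cst.
Qed.

End Extinction.

Theorem proposition7p4 (R : realType) (r : R) (Gamma : R -> set 'rV[R]_3)
    (r_gt0 : 0 < r)
    (HGamma : horizontal_mcf [set p : 'rV[R]_3 | koranyi p = r] Gamma) :
  let T := r ^+ 2 / Num.sqrt 12 in
  extinction_time Gamma T /\
  sets_converge_left
    (fun t => scale_set (Num.sqrt (r ^+ 4 - 12 * t ^+ 2)) (Gamma t)) T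
    [set P : 'rV[R]_3 |
      12 * T * (coord1 P ^+ 2 + coord2 P ^+ 2) + 16 * coord3 P ^+ 2 = 1].
Proof.
move=> T; have GammaE := flow_level_set r_gt0 HGamma.
have T_gt0 : 0 < T by exact: extinction_gt0.
have limit_set P : normalized_profile r P T =
    12 * T * (coord1 P ^+ 2 + coord2 P ^+ 2) + 16 * coord3 P ^+ 2.
  by rewrite /normalized_profile -(extinction_sqr r) subrr mul0r add0r.
have scaled t P : 0 <= t < T ->
    scale_set (Num.sqrt (r ^+ 4 - 12 * t ^+ 2)) (Gamma t) P <->
    normalized_profile r P t = 1.
  move=> tT; rewrite GammaE; first exact: normalized_level_set.
  by case/andP: tT.
split.
  split; first exact: ltW.
    move=> t /andP[t_ge0 tT]; rewrite GammaE//.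
    (* A pole of the level set; at [t = T] it is the origin. *)
    exists (hpoint 0 0 (Num.sqrt (r ^+ 4 - 12 * t ^+ 2) / 4)) => /=.
    rewrite /profile !coord_hpoint expr_div_n sqr_sqrtr -?le_extinction//.
    by field.
  move=> t Tt; have t_ge0 : 0 <= t by rewrite ltW// (lt_trans T_gt0).
  rewrite GammaE// -subset0 => p /= pr.
  move: Tt; rewrite ltNge => /negP; apply; rewrite le_extinction// -pr /profile.
  have rho_ge0 : 0 <= coord1 p ^+ 2 + coord2 p ^+ 2 by rewrite addr_ge0 ?sqr_ge0.
  have := mulr_ge0 t_ge0 rho_ge0; have := sqr_ge0 (coord1 p ^+ 2 + coord2 p ^+ 2).
  by have := sqr_ge0 (coord3 p); lra.
split.
  move=> t P Q tT SP t_cvg P_cvg /=; rewrite -limit_set.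
  by apply: (normalized_limit (t := t) (P := P)) => // j; apply/scaled.
move=> Q /=; rewrite -limit_set => /(normalized_approximation r_gt0)[P [P1 P_cvg]].
by exists P; split => // t tT; apply/scaled => //; exact: P1.
Qed.
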